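(* Let $\boldsymbol{\epsilon}=(\epsilon_y)_{y\in\mathbb{Z}}$ be a sequence of independent random variables with $\mathbb{P}(\epsilon_y=1)=\mathbb{P}(\epsilon_y=-1)=1/2$ for every $y$. Given $\boldsymbol{\epsilon}$, let $\mathbb{O}_{\boldsymbol{\epsilon}}$ be the directed graph with vertex set $\mathbb{Z}^2$ in which $(\mathbf{u},\mathbf{v})$ is a directed edge from $\mathbf{u}=(u_1,u_2)$ to $\mathbf{v}=(v_1,v_2)$ if and only if either $v_1=u_1$ and $v_2=u_2\pm1$, or $v_2=u_2$ and $v_1=u_1+\epsilon_{u_2}$. Then for almost all realisations of $\boldsymbol{\epsilon}$, the simple random walk $(\mathbf{M}_n)_{n\in\mathbb{N}}$ on $\mathbb{O}_{\boldsymbol{\epsilon}}$ is transient and its speed is $0$, i.e. $\lim_{n\to\infty}\mathbf{M}_n/n=0$ almost surely.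
   Context: The simple random walk on a directed graph with vertex set $\mathbb{V}$ and edge set $\mathbb{A}\subseteq \mathbb{V}\times\mathbb{V}$ (no loops, no multiple edges, finite out-degrees) is the $\mathbb{V}$-valued Markov chain $(\mathbf{M}_n)_{n\in\mathbb{N}}$ with transition probabilities $P_{\mathbf{u},\mathbf{v}}=\mathbb{P}(\mathbf{M}_{n+1}=\mathbf{v}\mid \mathbf{M}_n=\mathbf{u})=1/d^-_{\mathbf{u}}$ if $(\mathbf{u},\mathbf{v})\in\mathbb{A}$ and $0$ otherwise, where $d^-_{\mathbf{u}}=\mathrm{card}\{\mathbf{v}:(\mathbf{u},\mathbf{v})\in\mathbb{A}\}$ is the out-degree of $\mathbf{u}$. In the lattice considered here $d^-_{\mathbf{u}}=3$ for every $\mathbf{u}$. The environment $\boldsymbol{\epsilon}$ is sampled once and kept fixed during the evolution of the walk; ''for almost all realisations'' means for almost every $\boldsymbol{\epsilon}$ with respect to the law of the environment, and transience and the almost sure limit refer to the law of the walk in the fixed environment. Transient is meant in the usual sense for Markov chains: started from any vertex, the probability that the chain ever returns to that vertex is strictly less than $1$. *)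

(* Defs.v *)
From HB Require Import structures.
From mathcomp Require Import all_boot all_order all_algebra finmap.
From mathcomp Require Import all_classical all_reals all_analysis.

Set Implicit Arguments.
Unset Strict Implicit.
Unset Printing Implicit Defensive.

Import Order.TTheory GRing.Theory Num.Theory.
Import numFieldNormedType.Exports.

Local Open Scope classical_set_scope.
Local Open Scope ring_scope.

HB.instance Definition _ := isPointed.Build int 0.

(* int carries its discrete sigma-algebra; since int is countable, the product
   sigma-algebra on int * int is the discrete one as well. *)
HB.instance Definition _ := @isMeasurable.Build default_measure_display
  int discrete_measurable discrete_measurable0
  discrete_measurableC discrete_measurableU.

Section Probability.
Context d d' (T : measurableType d) (V : measurableType d') (R : realType).
Variable P : probability T R.

Definition mutually_independent (I : choiceType) (X : I -> {RV P >-> V}) :=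
  forall (J : {fset I}) (B : I -> set V), (forall j, measurable (B j)) ->
  fine (P (\bigcap_(j in [set` J]) (X j @^-1` B j))) =
  \prod_(j <- J) fine (P (X j @^-1` B j)).

Definition cond_prob (A B : set T) : R := fine (P (A `&` B)) / fine (P B).

(* Time-homogeneous Markov chain with transition probabilities p and arbitrary
   initial law; V is meant to be countable with measurable singletons. *)
Definition markov_chain (p : V -> V -> R) (M : nat -> {RV P >-> V}) :=
  forall (n : nat) (x : nat -> V),
  let past := \bigcap_(k in `I_n.+1) (M k @^-1` [set x k]) in
  (0 < P past)%E ->
  cond_prob (M n.+1 @^-1` [set x n.+1]) past = p (x n) (x n.+1).

End Probability.

Definition transient (R : realType) d' (V : measurableType d')
    (p : V -> V -> R) :=
  forall (u : V) (d : measure_display) (T : measurableType d)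
    (Q : probability T R) (M : nat -> {RV Q >-> V}),
  markov_chain p M -> Q (M 0%N @^-1` [set u]) = 1%E ->
  (Q (\bigcup_n (M n.+1 @^-1` [set u])) < 1)%E.

(* Only meaningful at vertices of finite out-degree: fset_set is fset0 on an
   infinite set. *)
Definition out_degree (V : choiceType) (A : rel V) (u : V) : nat :=
  #|` fset_set [set v | A u v]|.

Definition srw_trans (R : realType) (V : choiceType) (A : rel V) (u v : V) : R :=
  if A u v then (out_degree A u)%:R^-1 else 0.

Definition oriented_lattice (e : int -> int) : rel (int * int) :=
  fun u v =>
    ((v.1 == u.1) && ((v.2 == u.2 + 1) || (v.2 == u.2 - 1)))
    || ((v.2 == u.2) && (v.1 == u.1 + e u.2)).

Definition velocity (R : realType) (M : nat -> int * int) (n : nat) : R * R :=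
  ((M n).1%:~R / n%:R, (M n).2%:~R / n%:R).

(* The quantification over all probability spaces makes this a property of the
   law of the chain. *)
Definition zero_speed (R : realType) (p : int * int -> int * int -> R) :=
  forall (d : measure_display) (T : measurableType d) (Q : probability T R)
    (M : nat -> {RV Q >-> (int * int)%type}),
  markov_chain p M ->
  {ae Q, forall t, velocity R (fun n => M n t) @ \oo --> ((0, 0) : R * R)}.

(* Main.v *)
(** The vertical coordinate is a lazy simple random walk that does not see the
    environment, and given its path the horizontal displacement is
    [\sum_y eps_y N_y], with [N_y] the number of horizontal steps on line [y].

    Speed: averaged over the environment, the squared displacement at time [n] is
    at most the number of pairs of times at which the vertical walk is at the same
    height, of order [n^(3/2)].  Along [n = k^4] the normalised second moments are
    summable, so by Fubini they are summable in almost every environment, and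
    Borel-Cantelli applies; the walk is 1-Lipschitz in between.

    Transience: cut the time into blocks of two steps.  Exchanging the blocks
    "two horizontal steps" and "up, down" splits off from the displacement an
    independent simple random walk of [~ n] steps, which yields a factor
    [n^(-1/2)] in the return probability; the vertical return yields another one.
    Since there are at least [n^(1/2 - delta)] lines with [N_y >= n^(1/2 - delta)],
    the Littlewood-Offord inequality makes [|\sum_y eps_y N_y| <= n^(1/2 + delta)]
    unlikely, which gains a further power of [n].  The averaged return probability
    is thus summable, so almost every environment has a finite Green function,
    and a renewal argument at the last visit gives transience. *)
Require Import Defs.
From HB Require Import structures.
From mathcomp Require Import all_boot all_order all_algebra finmap.
From mathcomp Require Import all_classical all_reals all_analysis.
From mathcomp Require Import measurable_realfun.
From mathcomp Require Import ring lra zify.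

Set Implicit Arguments.
Unset Strict Implicit.
Unset Printing Implicit Defensive.

Import Order.TTheory GRing.Theory Num.Theory.
Import numFieldNormedType.Exports.

Local Open Scope ring_scope.

(** * Averages over words *)

(** Each step has probability [1/3] whatever the environment, so in a fixed environment the first
    [n] steps are uniform on words of length [n]. Until probability spaces enter, everything is thus
    a finite average, over words and over subsets of a finite window of lines. The obstacle to
    transience is that the counts [N_y], the simple walk and the vertical return come from the same
    word, whereas their gains must be multiplied. Hence a word is cut into three consecutive pieces:
    the first supplies the heavy lines, the exchanges in the first two supply the point bounds, and
    the third brings the vertical walk back. Up to constants, with [n] of order [x ^ 16], the simple
    walk and the vertical return yield [x ^- 8] each. Littlewood-Offord is applied to a window of
    width [x ^ 9] with at least [x ^ 6] lines of weight [x ^ 7], and yields [x ^ 2 / x ^ 3]. The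
    total [x ^- 17], that is [n^(-17/16)], is just beyond the threshold of summability; the
    sixteenth root keeps all these exponents integral. *)

Section WordAverage.
Variables (R : realFieldType) (T : finType).
Implicit Types (n : nat) (f g : seq T -> R).

Fixpoint avg n f : R :=
  if n is n'.+1 then (\sum_(a : T) avg n' (fun s => f (a :: s))) / #|T|%:R
  else f [::].

Lemma avg_le n f g : (forall s, size s = n -> f s <= g s) -> avg n f <= avg n g.
Proof.
elim: n f g => [|n IH] f g H /=; first exact: H.
rewrite ler_wpM2r ?invr_ge0 ?ler0n//; apply: ler_sum => a _.
by apply: IH => s hs; apply: H; rewrite /= hs.
Qed.

Lemma avg_eq n f g : (forall s, size s = n -> f s = g s) -> avg n f = avg n g.
Proof. by move=> H; apply/le_anti; rewrite !avg_le// => s /H ->. Qed.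

Lemma avgD n f g : avg n (fun s => f s + g s) = avg n f + avg n g.
Proof.
elim: n f g => [|n IH] f g //=.
by rewrite -mulrDl -big_split/=; congr (_ / _); apply: eq_bigr => a _; rewrite IH.
Qed.

Lemma avgZ n c f : avg n (fun s => c * f s) = c * avg n f.
Proof.
elim: n f => [|n IH] f //=.
by rewrite mulrA mulr_sumr; congr (_ / _); apply: eq_bigr => a _; rewrite IH.
Qed.

Lemma avgZr n c f : avg n (fun s => f s * c) = avg n f * c.
Proof. by rewrite mulrC -avgZ; apply: avg_eq => s _; rewrite mulrC. Qed.

Lemma avg0 n : avg n (fun=> 0) = 0.
Proof.
by have := avgZ n 0 (fun=> 0); rewrite !mul0r.
Qed.

Lemma avg_ge0 n f : (forall s, size s = n -> 0 <= f s) -> 0 <= avg n f.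
Proof. by move=> H; rewrite -(avg0 n); apply: avg_le. Qed.

Lemma avg_sum n (I : Type) (r : seq I) (P : pred I) (F : I -> seq T -> R) :
  avg n (fun s => \sum_(i <- r | P i) F i s) = \sum_(i <- r | P i) avg n (F i).
Proof.
elim: r => [|i r IH].
  rewrite big_nil -[RHS](avg0 n); by apply: avg_eq => s _; rewrite big_nil.
rewrite big_cons -IH; case: ifP => Pi; rewrite -?avgD; apply: avg_eq => s _;
  by rewrite big_cons Pi.
Qed.

Lemma avg_cat n m f :
  avg (n + m) f = avg n (fun s => avg m (fun t => f (s ++ t))).
Proof.
by elim: n f => [|n IH] f //=; congr (_ / _); apply: eq_bigr => a _; rewrite IH.
Qed.

Hypothesis T_gt0 : (0 < #|T|)%N.

Let cardT_neq0 : #|T|%:R != 0 :> R.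
Proof. by rewrite pnatr_eq0 -lt0n. Qed.

Lemma avg_cst n c : avg n (fun=> c) = c.
Proof.
elim: n => [|n IH] //=.
by under eq_bigr do rewrite IH; rewrite sumr_const -[c *+ _]mulr_natr mulfK.
Qed.

Lemma avg_le_cst n f c : (forall s, size s = n -> f s <= c) -> avg n f <= c.
Proof. by move=> H; rewrite -[leRHS](avg_cst n); apply: avg_le. Qed.

(** The letters are independent and centred: by [lin] the cross terms vanish and only [n] diagonal
    terms remain. *)
Lemma avg_sqr n (phi : T -> R) B : \sum_a phi a = 0 ->
  \sum_a phi a ^+ 2 <= B * #|T|%:R ->
  avg n (fun s => (\sum_(a <- s) phi a) ^+ 2) <= B * n%:R.
Proof.
move=> phi0 phiB.
have lin k c : avg k (fun s => c * (\sum_(a <- s) phi a)) = 0.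
  rewrite avgZ; apply/eqP; rewrite mulf_eq0; apply/orP; right.
  elim: k => [|k IH] /=; first by rewrite big_nil.
  rewrite (eq_bigr phi) ?phi0 ?mul0r// => a _.
  rewrite (@avg_eq _ _ (fun s => phi a + \sum_(b <- s) phi b)); last first.
    by move=> s _; rewrite big_cons.
  by rewrite avgD avg_cst (eqP IH) addr0.
elim: n => [|n IH] /=; first by rewrite big_nil expr0n mulr0.
rewrite (eq_bigr (fun a => phi a ^+ 2 + avg n (fun s => (\sum_(b <- s) phi b) ^+ 2))); last first.
  move=> a _; rewrite -[in RHS](avg_cst n (phi a ^+ 2)) -avgD.
  have := lin n (2 * phi a); set z := avg n _ => z0; rewrite -[RHS]addr0 -[X in _ + X]z0 -avgD.
  by apply: avg_eq => s _; rewrite big_cons; ring.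
set e := avg n _ in IH *.
rewrite big_split/= sumr_const -[e *+ _]mulr_natr mulrDl mulfK// -natr1 mulrDr mulr1 addrC lerD//.
by rewrite ler_pdivrMr// ltr0n.
Qed.

(** Chebyshev's inequality for the event that [p] occurs less than half as often as expected. The
    centred indicator [phi] is scaled by [#|T|] to avoid fractions. At [n = 0] both sides vanish,
    the inverse of [0] being [0]. *)
Lemma avg_count_lt n (p : pred T) : (0 < #|p|)%N ->
  avg n (fun s => (2 * #|T| * count p s < #|p| * n)%N%:R)
    <= (4 * #|T|%:R ^+ 2) / n%:R.
Proof.
move=> p0; case: n => [|n]; first by rewrite /= !muln0 ltnn invr0 mulr0.
set q : R := #|p|%:R; set t : R := #|T|%:R; set N : R := n.+1%:R.
pose phi a : R := t * (p a)%:R - q.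
have q1 : 1 <= q by rewrite ler1n.
have N0 : 0 < N by rewrite ltr0n.
have t0 : 0 < t by rewrite ltr0n.
have qt : q <= t by rewrite ler_nat max_card.
have sump : \sum_a (p a)%:R = q :> R.
  rewrite -natr_sum /q -sum1_card; congr ((_)%:R); rewrite [RHS]big_mkcond /=.
  by apply: eq_bigr => a _; rewrite -topredE /=; case: (p a).
have phi0 : \sum_a phi a = 0.
  by rewrite big_split/= -mulr_sumr sump sumr_const -[- q *+ _]mulr_natr mulNr mulrC subrr.
have sumphi s : \sum_(a <- s) phi a = t * (count p s)%:R - q * (size s)%:R.
  elim: s => [|a s IH]; first by rewrite big_nil /= !mulr0 subrr.
  by rewrite big_cons IH /phi /= natrD -natr1; ring.
have phiB : \sum_a phi a ^+ 2 <= t ^+ 2 * #|T|%:R.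
  rewrite mulr_natr -sumr_const; apply: ler_sum => a _.
  rewrite /phi; case: (p a) => /=; nra.
have := avg_sqr n.+1 phi0 phiB; rewrite -/N => A.
rewrite ler_pdivlMr//.
have -> : avg n.+1 (fun s => (2 * #|T| * count p s < #|p| * n.+1)%N%:R) * N =
  (avg n.+1 (fun s => (2 * #|T| * count p s < #|p| * n.+1)%N%:R * N ^+ 2)) / N.
  by rewrite avgZr expr2 mulrA mulfK ?gt_eqF.
rewrite ler_pdivrMr// -mulrA; apply: le_trans (ler_wpM2l (ler0n _ 4) A).
rewrite -avgZ; apply: avg_le => s ss; rewrite sumphi ss.
case: ltnP => [H|_] /=; last by rewrite mul0r mulr_ge0 ?sqr_ge0.
have {}H : 2 * t * (count p s)%:R < q * N by rewrite -!natrM ltr_nat.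
rewrite mul1r -/N.
have : N <= q * N by rewrite ler_peMl// ltW.
nra.
Qed.

End WordAverage.

Lemma avg_exchange (R : realFieldType) (S T : finType) n m
    (F : seq S -> seq T -> R) :
  avg n (fun s => avg m (F s)) = avg m (fun t => avg n (F^~ t)).
Proof.
elim: n F => [|n IH] F //=.
rewrite avgZr avg_sum; congr (_ / _); apply: eq_bigr => a _.
exact: IH (fun s => F (a :: s)).
Qed.

Definition flip T (sw : T -> T) (c : seq bool) (w : seq T) : seq T :=
  [seq if p.1 then sw p.2 else p.2 | p <- zip c w].

(** An involution permutes the letters, so applying it at positions chosen by fair coins preserves
    the uniform law. This creates fresh randomness independent of whatever [sw] leaves unchanged. *)
Lemma avg_flip (R : realFieldType) (T : finType) (sw : T -> T) n (f : seq T -> R) :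
  involutive sw ->
  avg n f = avg n (fun w => avg n (fun c => f (flip sw c w))).
Proof.
move=> swK; elim: n f => [|n IH] f //=; congr (_ / _); apply/esym.
rewrite (eq_bigr (fun a => (avg n (fun w => avg n (fun c => f (sw a :: flip sw c w))) +
   avg n (fun w => avg n (fun c => f (a :: flip sw c w)))) / 2)); last first.
  move=> a _; rewrite card_bool -avgD -avgZr; apply: avg_eq => w _.
  by rewrite big_bool.
rewrite -mulr_suml big_split/=.
rewrite [X in X + _](_ : _ = \sum_a avg n (fun w => avg n (fun c => f (a :: flip sw c w)))); last first.
  by rewrite [RHS](reindex_inj (inv_inj swK)).
rewrite -mulr2n -[X in X / _]mulr_natr mulfK ?pnatr_eq0//.
by apply: eq_bigr => a _; rewrite [RHS]IH.
Qed.

(** * Anticoncentration of sign sums *)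

Lemma leq_bin_half n k : ('C(n, k) <= 'C(n, n./2))%N.
Proof.
have low j : (j <= n./2)%N -> ('C(n, n./2 - j) <= 'C(n, n./2))%N.
  elim: j => [|j IH] jn; first by rewrite subn0.
  apply: leq_trans (IH (ltnW jn)).
  have -> : (n./2 - j = (n./2 - j.+1).+1)%N by lia.
  set i := (n./2 - j.+1)%N.
  have := mul_bin_left n i; have : (i.+1 <= n - i)%N by rewrite /i; lia.
  by move=> le e; rewrite -(leq_pmul2l (ltn0Sn i)) e leq_mul2r le orbT.
have [kn|kn] := leqP k n./2; first by have := low _ (leq_subr k _); rewrite subKn.
have [kn'|] := ltnP n k; first by rewrite bin_small.
move=> kn'; rewrite -bin_sub//.
have := low (n./2 - (n - k))%N (leq_subr _ _); rewrite subKn//; lia.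
Qed.

(** The ratio of consecutive central coefficients, [e1], reduces the induction step to
    [(2k+1)(2k+3) <= (2k+2)^2]. *)
Lemma sqr_bin_central k : ('C(k.*2, k) ^ 2 * (k.*2).+1 <= 16 ^ k)%N.
Proof.
elim: k => [|k IH] //; rewrite doubleS.
have e1 : (k.+1 * 'C(k.*2.+2, k.+1) = 2 * k.*2.+1 * 'C(k.*2, k))%N.
  have h1 := mul_bin_diag k.*2.+2 k; have h2 := mul_bin_left k.*2.+1 k.
  have h3 := mul_bin_down k.*2.+1 k; rewrite /= in h1 h3.
  apply/eqP; rewrite -(eqn_pmul2l (ltn0Sn k)); apply/eqP.
  have e : (k.*2.+1 - k = k.+1)%N by lia.
  rewrite e in h3; nia.
set a := 'C(k.*2, k) in IH e1; set b := 'C(_, _) in e1 *.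
rewrite -(@leq_pmul2l (k.+1 ^ 2)) ?expn_gt0// mulnA -expnMn e1 !expnMn [(16 ^ k.+1)%N]expnS.
apply: leq_trans (leq_mul (leqnn (k.+1 ^ 2)) (leq_mul (leqnn 16) IH)).
have -> : k.*2 = (2 * k)%N by lia.
have -> : (2 ^ 2 * (2 * k).+1 ^ 2 * a ^ 2 * (2 * k).+3 = 4 * (2 * k).+1 * a ^ 2 * ((2 * k).+1 * (2 * k).+3))%N by ring.
have -> : (k.+1 ^ 2 * (16 * (a ^ 2 * (2 * k).+1)) = 4 * (2 * k).+1 * a ^ 2 * (4 * k.+1 ^ 2))%N by ring.
rewrite leq_mul2l; apply/orP; right; lia.
Qed.

Lemma sqr_bin_le n k : ('C(n, k) ^ 2 * n.+1 <= 4 ^ n)%N.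
Proof.
apply: (@leq_trans ('C(n, n./2) ^ 2 * n.+1)).
  by rewrite leq_mul2r leq_exp2r// leq_bin_half orbT.
have := odd_double_half n; set h := n./2; case: (odd n) => /= <-; last first.
  rewrite add0n; apply: leq_trans (sqr_bin_central h) _.
  by rewrite -mul2n expnM.
(* An odd row has two equal central coefficients, whose sum is the central one of the next row. *)
have e : (2 * 'C(h.*2.+1, h) = 'C(h.*2.+2, h.+1))%N.
  rewrite binS; have <- := @bin_sub h.*2.+1 h.+1; last lia.
  by rewrite subSS -addnn addnK mul2n -addnn.
have := sqr_bin_central h.+1; rewrite doubleS -e add1n.
rewrite expnMn [(16 ^ h.+1)%N]expnS (_ : 4 ^ (h.*2).+1 = 4 * 16 ^ h)%N; last by rewrite expnS -mul2n expnM.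
set a := ('C(_, _) ^ 2)%N; set b := (16 ^ h)%N; rewrite (_ : 2 ^ 2 = 4)%N//; lia.
Qed.

(** * Antichains of finite sets *)

Section BinBound.
Variable R : rcfType.

Lemma bin_bound n k : 'C(n, k)%:R / 2 ^+ n <= (Num.sqrt n.+1%:R)^-1 :> R.
Proof.
rewrite ler_pdivrMr ?exprn_gt0// mulrC ler_pdivlMr ?sqrtr_gt0 ?ltr0n//.
rewrite -(@ler_pXn2r _ 2)// ?nnegrE ?mulr_ge0 ?sqrtr_ge0 ?ler0n ?exprn_ge0//.
rewrite exprMn sqr_sqrtr ?ler0n// -exprM mulnC exprM -!natrX -natrM ler_nat.
exact: sqr_bin_le.
Qed.

Variable T : finType.
Implicit Types (S A : {set T}) (F : {set {set T}}).

(* LYM inequality: the induction removes one point [x] of [S] at a time and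
   averages over [x]. *)
Lemma lym S F :
  {in F, forall A : {set T}, A \subset S} -> {in F &, forall A B : {set T}, A \subset B -> A = B} ->
  \sum_(A in F) ('C(#|S|, #|A|)%:R)^-1 <= 1 :> R.
Proof.
have [s sS] := ubnP #|S|; elim: s S F sS => // s IH S F sS FS FA.
have [SF|SF] := boolP (S \in F).
  have -> : \sum_(A in F) ('C(#|S|, #|A|)%:R)^-1 = ('C(#|S|, #|S|)%:R)^-1 :> R.
    rewrite (bigD1 S)//= big1 ?addr0// => A /andP[AF /negP AS].
    by case: AS; apply/eqP; apply: FA => //; exact: FS.
  by rewrite binn invr1.
have FS' A : A \in F -> (#|A| < #|S|)%N.
  move=> AF; apply: proper_card; rewrite finset.properEneq FS// andbT.
  by apply: contraNneq SF => <-.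
have [S0|S0] := posnP #|S|.
  rewrite big1 ?ler01// => A /FS'; by rewrite S0.
rewrite -(@ler_pM2l _ #|S|%:R) ?ltr0n// mulr1 mulr_sumr.
apply: (@le_trans _ _ (\sum_(x in S) 1)); last by rewrite sumr_const.
apply: (@le_trans _ _ (\sum_(x in S) \sum_(A in F | x \notin A) ('C(#|S|.-1, #|A|)%:R)^-1)).
  rewrite (exchange_big_dep (mem F))//=; last by move=> x A _ /andP[].
  apply: ler_sum => A AF; have AS := FS' A AF.
  rewrite sumr_const.
  have -> : #|[pred i in S | (A \in F) && (i \notin A)]| = (#|S| - #|A|)%N.
    have <- : #|S :\: A| = (#|S| - #|A|)%N by rewrite cardsD (finset.setIidPr (FS A AF)).
    apply: eq_card => x; rewrite !inE.
    by apply/and3P/andP => [[xS _ xA]|[xA xS]]; split.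
  rewrite -[leRHS]mulr_natl.
  have h := mul_bin_down #|S| #|A|.
  have c1 : (0 < 'C(#|S|.-1, #|A|))%N by rewrite bin_gt0; lia.
  have c2 : (0 < 'C(#|S|, #|A|))%N by rewrite bin_gt0; lia.
  rewrite ler_pdivrMr ?ltr0n// mulrAC ler_pdivlMr ?ltr0n// -!natrM ler_nat.
  by rewrite h.
apply: ler_sum => x xS.
have e : #|S :\ x| = #|S|.-1 by rewrite [in RHS](cardsD1 x) xS.
rewrite -e.
rewrite (_ : \sum_(A in F | x \notin A) _ = \sum_(A in [set A in F | x \notin A]) ('C(#|S :\ x|, #|A|)%:R)^-1); last first.
  by apply: eq_bigl => A; rewrite !inE.
apply: IH; first by rewrite e; lia.
  by move=> A; rewrite inE => /andP[AF xA]; rewrite subsetD1 FS.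
by move=> A B; rewrite !inE => /andP[AF _] /andP[BF _]; exact: FA.
Qed.

(** By [bin_bound], every term of the LYM sum is at least [Num.sqrt #|S|.+1%:R / 2 ^+ #|S|]. *)
Lemma sperner S F :
  {in F, forall A : {set T}, A \subset S} -> {in F &, forall A B : {set T}, A \subset B -> A = B} ->
  #|F|%:R / 2 ^+ #|S| <= (Num.sqrt #|S|.+1%:R)^-1 :> R.
Proof.
move=> FS FA; rewrite ler_pdivrMr ?exprn_gt0//; set M := _ * _.
have M0 : 0 < M by rewrite mulr_gt0 ?invr_gt0 ?sqrtr_gt0 ?ltr0n ?exprn_gt0.
rewrite -[M]mul1r -ler_pdivrMr//; apply: le_trans (lym FS FA).
rewrite -sumr_const mulr_suml; apply: ler_sum => A AF.
have c0 : (0 < 'C(#|S|, #|A|))%N by rewrite bin_gt0 subset_leq_card// FS.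
rewrite mul1r lef_pV2 ?posrE ?ltr0n// -ler_pdivrMr ?exprn_gt0//.
exact: bin_bound.
Qed.
End BinBound.

(** * Littlewood-Offord inequality and second moment of sign sums *)

Definition sg (b : bool) : int := if b then 1 else -1.

Definition sgsum (I : finType) (a : I -> int) (A : {set I}) : int :=
  \sum_i sg (i \in A) * a i.

Section SetAverage.
Variables (R : rcfType) (I : finType).
Implicit Types (A B : {set I}) (G : {set I} -> R).

Definition setavg G : R := (\sum_A G A) / 2 ^+ #|I|.

Lemma setavg_le G G' : (forall A, G A <= G' A) -> setavg G <= setavg G'.
Proof. by move=> H; rewrite ler_wpM2r ?invr_ge0 ?exprn_ge0// ler_sum. Qed.

Lemma setavg_eq G G' : (forall A, G A = G' A) -> setavg G = setavg G'.
Proof. by move=> H; apply/le_anti; rewrite !setavg_le// => A; rewrite H. Qed.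

Lemma setavgD G G' : setavg (fun A => G A + G' A) = setavg G + setavg G'.
Proof. by rewrite /setavg big_split mulrDl. Qed.

Lemma setavgZ c G : setavg (fun A => c * G A) = c * setavg G.
Proof. by rewrite /setavg -mulr_sumr mulrA. Qed.

Lemma setavg_sum J (r : seq J) (P : pred J) (F : J -> {set I} -> R) :
  setavg (fun A => \sum_(j <- r | P j) F j A) = \sum_(j <- r | P j) setavg (F j).
Proof. by rewrite /setavg exchange_big mulr_suml. Qed.

Lemma setavg_cst c : setavg (fun=> c) = c.
Proof.
have cardI : #|{: {set I}}| = (2 ^ #|I|)%N.
  by rewrite -[#|{set I}|]cardsT -powersetT card_powerset cardsT.
rewrite /setavg sumr_const cardI.
by rewrite -[X in X / _]mulr_natr natrX mulfK// expf_neq0// pnatr_eq0.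
Qed.

Lemma setavg_le_cst G c : (forall A, G A <= c) -> setavg G <= c.
Proof. by move=> H; rewrite -[leRHS]setavg_cst; exact: setavg_le. Qed.

Lemma setavg_avg (T : finType) n (F : {set I} -> seq T -> R) :
  setavg (fun A => avg n (F A)) = avg n (fun s => setavg (F^~ s)).
Proof. by rewrite /setavg -avg_sum avgZr. Qed.

Lemma sgsum_lt (a : I -> int) A B i : {in B :\: A, forall j, 0 <= a j} ->
  A \subset B -> i \in B :\: A -> sgsum a A + 2 * a i <= sgsum a B.
Proof.
move=> a0 AB iBA; have := iBA; rewrite inE => /andP[iA iB].
rewrite /sgsum (bigD1 i)//= [leRHS](bigD1 i)//= (negbTE iA) iB /sg mul1r mulN1r.
rewrite addrAC lerD//; first by lia.
apply: ler_sum => j ji; have := a0 j; rewrite inE.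
case: (boolP (j \in A)) => jA /=; first by rewrite (fintype.subsetP AB).
by case: (j \in B) => //= /(_ isT); lia.
Qed.

(** Erdos's argument: once the signs off [H] are frozen, the traces on [H] of the favourable sets
    form an antichain, because enlarging a trace raises the sum by at least [2 * L], the length of
    the half-open window. Sperner's bound then applies to each fibre. *)
Lemma littlewood_offord (a : I -> int) (H : {set I}) (L x : R) :
  0 < L -> {in H, forall i, L <= (a i)%:~R} ->
  setavg (fun A => (x <= (sgsum a A)%:~R < x + 2 * L)%R%:R)
    <= (Num.sqrt #|H|.+1%:R)^-1.
Proof.
move=> L0 aL; pose g A := x <= (sgsum a A)%:~R < x + 2 * L.
rewrite -[setavg _]/(setavg (fun A => (g A)%:R)).
rewrite /setavg ler_pdivrMr ?exprn_gt0//.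
rewrite (partition_big (fun A => A :\: H) (fun B => B \in powerset (~: H)))/=; last first.
  by move=> A _; rewrite powersetE finset.setDE subsetIr.
pose m : R := (Num.sqrt #|H|.+1%:R)^-1 * 2 ^+ #|H|.
apply: (@le_trans _ _ (\sum_(B in powerset (~: H)) m)); last first.
  rewrite sumr_const card_powerset -[leLHS]mulr_natr natrX /m -mulrA -exprD.
  by rewrite cardsC.
apply: ler_sum => B BH.
pose FA := [set A | (A :\: H == B) && g A].
have -> : \sum_(A | A :\: H == B) (g A)%:R = #|FA|%:R :> R.
  rewrite -natr_sum -sum1_card big_mkcond [in RHS]big_mkcond; congr ((_)%:R).
  by apply: eq_bigr => A _; rewrite inE; case: (_ == _); case: (g A).
pose F := [set A :&: H | A in FA].
have FAE A : A \in FA -> A = (A :&: H) :|: B.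
  by rewrite inE => /andP[/eqP <- _]; rewrite setID.
have <- : #|F| = #|FA|.
  by apply: card_in_imset => A A' /FAE {2}-> /FAE {2}-> ->.
rewrite -ler_pdivrMr ?exprn_gt0//; apply: sperner.
  by move=> _ /imsetP[A _ ->]; rewrite subsetIr.
move=> _ _ /imsetP[A AF ->] /imsetP[A' AF' ->] AA'.
have sAA' : A \subset A' by rewrite (FAE _ AF) (FAE _ AF') finset.setSU.
have [e|] := eqVneq A A'; first by rewrite e.
move=> neq; have : A \proper A' by rewrite finset.properEneq neq.
case/properP => _ [i iA' iA].
have iH j : j \in A' :\: A -> j \in H.
  rewrite inE => /andP[jA jA']; apply: contraNT jA => jH.
  have := AF'; rewrite inE => /andP[/eqP e' _].
  have : j \in A :\: H by have := AF; rewrite inE => /andP[/eqP -> _]; rewrite -e' inE jH.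
  by rewrite inE => /andP[].
have iD : i \in A' :\: A by rewrite inE iA.
have := @sgsum_lt a A A' i _ sAA' iD.
have a0 : {in A' :\: A, forall j, 0 <= a j}.
  by move=> j /iH/aL; move=> h; rewrite -(ler0z R); apply: le_trans h; exact: ltW.
move=> /(_ a0); rewrite -(ler_int R) intrD intrM => hlt.
have := AF; rewrite inE => /andP[_ /andP[h1 h2]].
have := AF'; rewrite inE => /andP[_ /andP[h3 h4]].
by exfalso; have := aL _ (iH _ iD); lra.
Qed.

Lemma littlewood_offord_window (a : I -> int) (H : {set I}) (L x t : R) q :
  0 < L -> {in H, forall i, L <= (a i)%:~R} -> t < q%:R * L ->
  setavg (fun A => (`|(sgsum a A)%:~R - x| <= t)%R%:R)
    <= q%:R / Num.sqrt #|H|.+1%:R.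
Proof.
move=> L0 aL tq.
(* Left ends of adjacent half-open windows of length [2 * L]; by [t < q%:R * L] the [q] of them
   reach strictly beyond the closed end [x + t]. *)
pose w (j : nat) : R := x - t + 2 * L * j%:R.
apply: (@le_trans _ _ (setavg (fun A => \sum_(j < q)
    (w j <= (sgsum a A)%:~R < w j + 2 * L)%R%:R))).
  apply: setavg_le => A; case: (lerP `|(sgsum a A)%:~R - x| t) => [|_]/=; last by apply: sumr_ge0.
  rewrite ler_norml => /andP[h1 h2]; set z : R := _%:~R in h1 h2 *.
  have : exists j : 'I_q, w j <= z < w j + 2 * L.
    have zq : z < w q by rewrite /w; nra.
    have z0 : w 0%N <= z by rewrite /w; lra.
    elim: q zq {tq} => [|q IH] zq; first by have := le_lt_trans z0 zq; rewrite ltxx.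
    have [zq'|qz] := ltP z (w q).
      by have [j hj] := IH zq'; exists (widen_ord (leqnSn q) j).
    exists ord_max; rewrite qz /=; move: zq; rewrite /w -natr1; lra.
  by case=> j hj; rewrite (bigD1 j)//= hj lerDl; apply: sumr_ge0.
have -> : q%:R / Num.sqrt #|H|.+1%:R = \sum_(j < q) (Num.sqrt #|H|.+1%:R)^-1 :> R.
  by rewrite sumr_const card_ord mulr_natl.
rewrite setavg_sum.
by apply: ler_sum => j _; apply: littlewood_offord.
Qed.

Lemma setavg_sgsum_sqr (a : I -> int) :
  setavg (fun A => (sgsum a A)%:~R ^+ 2) = \sum_i (a i)%:~R ^+ 2.
Proof.
have key i j : setavg (fun A => (sg (i \in A) * sg (j \in A))%:~R) = (i == j)%:R.
  have [<-|ij] := eqVneq i j.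
    rewrite -[RHS](setavg_cst 1); apply: setavg_eq => A.
    by rewrite /sg; case: (i \in A); rewrite ?mulN1r ?opprK ?mul1r.
  set x := LHS; suff : x = - x by rewrite /=; lra.
  rewrite /x.
  (* Toggling [i] alone is an involution that reverses the sign of the product, since [i != j]. *)
  pose f A := if i \in A then A :\ i else i |: A.
  have fK : involutive f.
    move=> A; rewrite /f; case: (boolP (i \in A)) => iA.
      by rewrite setD11 finset.setD1K.
    by rewrite setU11 setU1K.
  rewrite {1}/setavg (reindex_inj (inv_inj fK)) -mulNr -sumrN.
  congr (_ / _); apply: eq_bigr => A _; rewrite -rmorphN -mulNr /f.
  have [iA|iA] := boolP (i \in A); rewrite !inE eqxx eq_sym (negbTE ij)/=;
    by rewrite /sg ?opprK.
rewrite (setavg_eq (G' := fun A =>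
   \sum_i \sum_j ((a i)%:~R * (a j)%:~R) * (sg (i \in A) * sg (j \in A))%:~R)); last first.
  move=> A; rewrite expr2 /sgsum raddf_sum/= mulr_suml; apply: eq_bigr => i _.
  by rewrite mulr_sumr; apply: eq_bigr => j _; rewrite !intrM; ring.
rewrite setavg_sum; apply: eq_bigr => i _; rewrite setavg_sum (bigD1 i)//= big1.
  by rewrite addr0 setavgZ key eqxx mulr1 expr2.
by move=> j ji; rewrite setavgZ key eq_sym (negbTE ji) mulr0.
Qed.

End SetAverage.

(** * The simple random walk driven by coins *)

Section SimpleWalk.
Variable R : rcfType.

Definition srw (c : seq bool) : int := \sum_(b <- c) sg b.

Lemma srw_cat c c' : srw (c ++ c') = srw c + srw c'.
Proof. exact: big_cat. Qed.

Lemma srw_cons b c : srw (b :: c) = sg b + srw c.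
Proof. exact: big_cons. Qed.

Lemma avg_boolS n (f : seq bool -> R) :
  avg n.+1 f = (avg n (fun c => f (true :: c)) + avg n (fun c => f (false :: c))) / 2.
Proof. by rewrite /= card_bool big_bool. Qed.

Lemma srw_bin n k :
  avg n (fun c => (count id c == k)%:R) = 'C(n, k)%:R / 2 ^+ n :> R.
Proof.
elim: n k => [|n IH] k; first by rewrite /= bin0n eq_sym expr0 divr1.
rewrite avg_boolS.
have -> : avg n (fun c => (count id (false :: c) == k)%:R) = 'C(n, k)%:R / 2 ^+ n :> R.
  by rewrite -IH.
have -> : avg n (fun c => (count id (true :: c) == k)%:R) =
    (if k is k'.+1 then 'C(n, k')%:R else 0) / 2 ^+ n :> R.
  case: k => [|k]; first by rewrite mul0r; exact: avg0.
  by rewrite -IH; apply: avg_eq => c _; rewrite /= eqSS.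
rewrite -mulrDl -mulrA -invfM -exprSr; congr (_ / _).
by case: k => [|k]; rewrite ?bin0 ?add0r// binS natrD addrC.
Qed.

Lemma srw_count c : srw c = (count id c)%:R *+ 2 - (size c)%:R.
Proof.
elim: c => [|b c IH]; first by rewrite /srw big_nil.
by rewrite srw_cons IH; case: b => /=; rewrite /sg; lia.
Qed.

Lemma srw_point n z :
  avg n (fun c => (srw c == z)%:R) <= (Num.sqrt n.+1%:R)^-1 :> R.
Proof.
(* The number of up-steps forced by the endpoint [z]; when [z] is out of reach or of the wrong
   parity, the left side is [0] and the value of [k] is irrelevant. *)
pose k := `|(z + n%:Z) %/ 2|%Z%N.
apply: le_trans (bin_bound R n k); rewrite -srw_bin; apply: avg_le => c cn.
rewrite ler_nat srw_count cn.
case: eqP => //= h; rewrite lt0b; apply/eqP; rewrite /k; lia.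
Qed.

Lemma srw_sqr n : avg n (fun c => (srw c)%:~R ^+ 2) <= n%:R :> R.
Proof.
rewrite -[leRHS]mul1r (avg_eq (g := fun c => (\sum_(b <- c) (sg b)%:~R) ^+ 2)); last first.
  by move=> c _; rewrite /srw raddf_sum.
apply: (@avg_sqr R bool _ n (fun b => (sg b)%:~R)).
- by rewrite card_bool.
- by rewrite big_bool /sg /= addrN.
- by rewrite big_bool card_bool /sg /=; lra.
Qed.

End SimpleWalk.

(** * Step words *)

(* [Some true] is a step up, [Some false] a step down, and [None] a step along
   the horizontal line, in the direction prescribed by the environment. *)
Definition step := option bool.

Lemma card_step : #|{: step}| = 3%N.
Proof. by rewrite card_option card_bool. Qed.

Definition vstep (a : step) : int := if a is Some b then sg b else 0.

Definition dy (s : seq step) : int := \sum_(a <- s) vstep a.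

Fixpoint dx (beta : int -> bool) (y : int) (s : seq step) : int :=
  if s is a :: s' then
    (if a is None then sg (beta y) else 0) + dx beta (y + vstep a) s'
  else 0.

(* Words are read from height [y]; the height reached at the end of the word does
   not count as a visit. *)
Fixpoint hsteps (z y : int) (s : seq step) : nat :=
  if s is a :: s' then ((a == None) && (z == y) + hsteps z (y + vstep a) s')%N
  else 0%N.

Fixpoint visits (z y : int) (s : seq step) : nat :=
  if s is a :: s' then ((z == y) + visits z (y + vstep a) s')%N else 0%N.

(* [\sum_z visits z y s ^ 2], see [sum_sqr_visits] *)
Fixpoint collisions (y : int) (s : seq step) : nat :=
  if s is a :: s' then
    (1 + 2 * visits y (y + vstep a) s' + collisions (y + vstep a) s')%N
  else 0%N.

(* [\sum_z visits z y s * (z - y0) ^ 2], see [sum_visits_sqr] *)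
Fixpoint spread (y0 y : int) (s : seq step) : int :=
  if s is a :: s' then (y - y0) ^+ 2 + spread y0 (y + vstep a) s' else 0.

Lemma dy_cat s t : dy (s ++ t) = dy s + dy t.
Proof. exact: big_cat. Qed.

Lemma dy_cons a s : dy (a :: s) = vstep a + dy s.
Proof. exact: big_cons. Qed.

Lemma dy_nil : dy [::] = 0.
Proof. exact: big_nil. Qed.

Lemma dx_cat beta y s t : dx beta y (s ++ t) = dx beta y s + dx beta (y + dy s) t.
Proof.
elim: s y => [|a s IH] y /=; first by rewrite dy_nil addr0 add0r.
by rewrite IH dy_cons !addrA.
Qed.

Lemma hsteps_cat z y s t :
  hsteps z y (s ++ t) = (hsteps z y s + hsteps z (y + dy s) t)%N.
Proof.
elim: s y => [|a s IH] y /=; first by rewrite dy_nil addr0 add0n.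
by rewrite IH dy_cons !addrA addnA.
Qed.

Lemma visits_cat z y s t :
  visits z y (s ++ t) = (visits z y s + visits z (y + dy s) t)%N.
Proof.
elim: s y => [|a s IH] y /=; first by rewrite dy_nil addr0 add0n.
by rewrite IH dy_cons !addrA addnA.
Qed.

Lemma spread_cat y0 y s t :
  spread y0 y (s ++ t) = spread y0 y s + spread y0 (y + dy s) t.
Proof.
elim: s y => [|a s IH] y /=; first by rewrite dy_nil addr0 add0r.
by rewrite IH dy_cons !addrA.
Qed.

Lemma hsteps_le_visits z y s : (hsteps z y s <= visits z y s)%N.
Proof.
elim: s y => [|a s IH] y //=; apply: leq_add => //.
by case: (a == None).
Qed.

Lemma vstep_norm a : `|vstep a| <= 1.
Proof. by case: a => [[]|]. Qed.

(** Every step changes the sum of the coordinates by [1] or [-1]: the lattice is bipartite, which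
    excludes returns at odd times. *)
Lemma parity_dx_dy beta y s :
  exists k : int, dx beta y s + dy s = (size s)%:Z + k *+ 2.
Proof.
elim: s y => [|a s IH] y; first by exists 0; rewrite /= dy_nil mul0rn.
have [k hk] := IH (y + vstep a); rewrite /= dy_cons.
case: a hk => [[]|] hk; [exists k|exists (k - 1)|exists (if beta y then k else k - 1)].
- by move: hk; rewrite /= /sg; lia.
- by move: hk; rewrite /= /sg; lia.
- by move: hk; rewrite /= /sg; case: (beta y) => /=; lia.
Qed.

Section Window.
Variables (n : nat) (y0 : int).

(** The heights within distance [n] of [y0]. A word of length [n] read from [y0] never leaves them,
    so sums over all lines become finite and an environment becomes a subset of ['I_(n.*2.+1)]. *)
Definition level (i : 'I_(n.*2.+1)) : int := y0 + (i : nat)%:Z - n%:Z.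

Lemma level_inj : injective level.
Proof. by move=> i j; rewrite /level => /eqP h; apply/val_inj => /=; lia. Qed.

Lemma level_onto (y : int) : `|y - y0| <= n%:Z -> exists i, level i = y.
Proof.
move=> h; have hi : (absz (y - y0 + n%:Z)%R < n.*2.+1)%N by lia.
by exists (Ordinal hi); rewrite /level /=; lia.
Qed.

Lemma sum_level (V : pzRingType) (F : int -> V) (y : int) : `|y - y0| <= n%:Z ->
  \sum_i F (level i) * (level i == y)%:R = F y.
Proof.
case/level_onto => i0 <-; rewrite (bigD1 i0)//= eqxx mulr1 big1 ?addr0// => i ii0.
by rewrite (inj_eq level_inj) (negbTE ii0) mulr0.
Qed.

Lemma shift_level y a k : `|y - y0| + k.+1%:Z <= n%:Z ->
  `|y + vstep a - y0| + k%:Z <= n%:Z.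
Proof. by have := vstep_norm a; lia. Qed.

Lemma dx_sgsum beta y s : `|y - y0| + (size s)%:Z <= n%:Z ->
  dx beta y s = sgsum (fun i => (hsteps (level i) y s)%:Z) [set i | beta (level i)].
Proof.
elim: s y => [|a s IH] y h /=.
  by rewrite /sgsum big1// => i _; rewrite mulr0.
rewrite (IH _ (shift_level a h)) /sgsum.
rewrite -[X in X + _](_ : \sum_i sg (beta (level i)) * ((a == None) && (level i == y))%:Z = _).
  rewrite -big_split/=; apply: eq_bigr => i _.
  by rewrite PoszD mulrDr inE.
case: a h => [b|] h /=; first by rewrite big1// => i _; rewrite mulr0.
rewrite -(sum_level (fun z => sg (beta z)) (y := y)); last by rewrite /= in h; lia.
by apply: eq_bigr => i _; rewrite natz.
Qed.

Lemma sum_sqr_visits y s : `|y - y0| + (size s)%:Z <= n%:Z ->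
  (\sum_i visits (level i) y s ^ 2)%N = collisions y s.
Proof.
elim: s y => [|a s IH] y h /=; first by rewrite big1.
rewrite -(IH _ (shift_level a h)).
have hy : `|y - y0| <= n%:Z by rewrite /= in h; lia.
have := @sum_level int (fun z => 1 + 2 * (visits z (y + vstep a) s)%:R) y hy.
rewrite (eq_bigr (fun i => ((level i == y) * (1 + 2 * visits (level i) (y + vstep a) s))%N%:R)); last first.
  by move=> i _; rewrite natrM natrD natrM mulrC.
rewrite -natr_sum -[1 + _]/(1%:R + 2%:R * (visits y (y + vstep a) s)%:R) -natrM -natrD !natz => -[<-].
rewrite -big_split/=; apply: eq_bigr => i _.
by case: (_ == _) => /=; ring.
Qed.

Lemma sum_visits_sqr y s : `|y - y0| + (size s)%:Z <= n%:Z ->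
  \sum_i (visits (level i) y s)%:Z * (level i - y0) ^+ 2 = spread y0 y s.
Proof.
elim: s y => [|a s IH] y h /=; first by rewrite big1// => i _; rewrite mul0r.
rewrite -(IH _ (shift_level a h)).
have hy : `|y - y0| <= n%:Z by rewrite /= in h; lia.
rewrite -(sum_level (fun z => (z - y0) ^+ 2) hy) -big_split/=.
by apply: eq_bigr => i _; rewrite PoszD mulrDl natz [in RHS]mulrC.
Qed.

Lemma sum_hsteps y s : `|y - y0| + (size s)%:Z <= n%:Z ->
  (\sum_i hsteps (level i) y s)%N = count_mem None s.
Proof.
elim: s y => [|a s IH] y h /=; first by rewrite big1.
rewrite big_split/= (IH _ (shift_level a h)); congr addn.
have hy : `|y - y0| <= n%:Z by rewrite /= in h; lia.
case: (a == None) => /=; last by rewrite big1.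
have := @sum_level int (fun=> 1) y hy.
rewrite (eq_bigr (fun i => (level i == y)%:R)); last by move=> i _; rewrite mul1r.
by rewrite -natr_sum natz => -[].
Qed.

End Window.

Lemma sum_step (V : nmodType) (F : step -> V) :
  \sum_a F a = F None + F (Some true) + F (Some false).
Proof.
rewrite (bigD1 None)//= (bigD1 (Some true))//= (bigD1 (Some false))//= big1 ?addr0 ?addrA//.
by case=> [[]|].
Qed.

(** * Point bound and moments of the vertical walk *)

Section StepAverages.
Variable R : rcfType.

Let step_gt0 : (0 < #|{: step}|)%N. Proof. by rewrite card_step. Qed.

Definition vflip (a : step) : step := if a is Some b then Some (~~ b) else None.

Lemma vflipK : involutive vflip.
Proof. by case=> [[]|]. Qed.

(** With the horizontal steps kept in place, fresh signs on the vertical ones turn the lazy walk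
    into a simple walk whose length is determined by [s]. *)
Lemma avg_vflip (s : seq step) (phi : int -> R) :
  avg (size s) (fun c => phi (dy (flip vflip c s))) =
  avg (count isSome s) (fun c => phi (srw c)).
Proof.
elim: s phi => [|a s IH] phi; first by rewrite /= dy_nil /srw big_nil.
rewrite [size _]/= avg_boolS.
have E b : avg (size s) (fun c => phi (dy (flip vflip (b :: c) (a :: s)))) =
    avg (count isSome s) (fun c => phi (vstep (if b then vflip a else a) + srw c)).
  rewrite -[RHS](IH (fun z => phi (_ + z))); apply: avg_eq => c _.
  by rewrite -dy_cons.
rewrite !E; case: a {E} => [b|].
  rewrite -[count _ (_ :: _)]/(count isSome s).+1 avg_boolS.
  have F e : avg (count isSome s) (fun c => phi (srw (e :: c))) =
      avg (count isSome s) (fun c => phi (sg e + srw c)).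
    by apply: avg_eq => c _; rewrite srw_cons.
  by rewrite !F; case: b; rewrite //= [in LHS]addrC.
rewrite -[count _ (_ :: _)]/(count isSome s) -mulr2n -[X in X / _]mulr_natr mulfK ?pnatr_eq0//.
by apply: avg_eq => c _; rewrite add0r.
Qed.

Lemma natr_sqrt_le n : (n%:R)^-1 <= 2 / Num.sqrt n.+1%:R :> R.
Proof.
case: n => [|n]; first by rewrite invr0 divr_ge0 ?sqrtr_ge0.
rewrite ler_pdivlMr ?sqrtr_gt0 ?ltr0n// mulrC ler_pdivrMr ?ltr0n//.
have : Num.sqrt n.+2%:R <= n.+2%:R :> R.
  rewrite -[leRHS]sqr_sqrtr ?ler0n// expr2 ler_peMl ?sqrtr_ge0//.
  by rewrite -[leLHS]sqrtr1 ler_sqrt ?ltr0n// ler1n.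
move=> /le_trans; apply; rewrite -natrM ler_nat; lia.
Qed.

Lemma dy_point n z :
  avg n (fun s => (dy s == z)%:R) <= 74 / Num.sqrt n.+1%:R :> R.
Proof.
rewrite (avg_flip _ _ vflipK).
(* Words with fewer than [n / 3] vertical steps, half of the expected number; Chebyshev bounds their
   proportion by [36 / n]. *)
pose bad (s : seq step) : R := (2 * #|{: step}| * count isSome s < #|isSome : pred step| * n)%N%:R.
have cV : #|isSome : pred step| = 2%N.
  rewrite (eq_card (B := [set Some true; Some false])); last by case=> [[]|]; rewrite !inE.
  by rewrite cards2.
have sq0 k : 0 < Num.sqrt k.+1%:R :> R by rewrite sqrtr_gt0 ltr0n.
apply: (@le_trans _ _ (avg n (fun s => bad s + 2 / Num.sqrt n.+1%:R))).
  apply: avg_le => s sn; rewrite -sn.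
  rewrite (avg_vflip s (fun x => (x == z)%:R)); apply: le_trans (srw_point R _ _) _.
  rewrite /bad cV card_step sn; case: ltnP => [lt|ge] /=.
    rewrite -[leLHS]addr0 lerD ?divr_ge0 ?sqrtr_ge0//.
    by rewrite invf_le1// -[leLHS]sqrtr1 ler_sqrt ?ltr0n// ler1n.
  rewrite add0r ler_pdivlMr// mulrC ler_pdivrMr//.
  rewrite -(@ler_pXn2r _ 2)// ?nnegrE ?mulr_ge0 ?sqrtr_ge0//.
  rewrite exprMn !sqr_sqrtr ?ler0n// -natrX -natrM ler_nat; lia.
rewrite avgD (avg_cst step_gt0).
have := @avg_count_lt R _ step_gt0 n isSome; rewrite -[avg n _]/(avg n bad) cV card_step => /(_ isT).
have := natr_sqrt_le n; set q := _ / _; set p := _^-1 => h1 h2.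
(* The bad words cost [36 * q], through [1 / n <= q], and the good ones cost [q = 2 / sqrt (n + 1)];
   hence [74 = 2 * 36 + 2]. *)
have -> : 74 / Num.sqrt n.+1%:R = 36 * q + q :> R by rewrite /q; lra.
rewrite lerD// (le_trans h2)// -/p; lra.
Qed.

Lemma avg_visits n z y :
  avg n (fun s => (visits z y s)%:R) <= 148 * Num.sqrt n%:R :> R.
Proof.
elim: n => [|n IH]; first by rewrite /= sqrtr0 mulr0.
rewrite -addn1 avg_cat.
(* Since [visits] ignores the final height, one more letter adds exactly the visit at the height
   reached by [s]. *)
rewrite (avg_eq (g := fun s => (visits z y s)%:R + (dy s == z - y)%:R)); last first.
  move=> s _; rewrite -[RHS](avg_cst step_gt0 1); apply: avg_eq => -[|a []]// _.
  by rewrite visits_cat /= addn0 natrD [dy s == _]eq_sym subr_eq [dy s + y]addrC.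
rewrite avgD; apply: le_trans (lerD IH (dy_point n (z - y))) _; rewrite addn1.
set a := Num.sqrt n%:R; set b := Num.sqrt n.+1%:R.
have a0 : 0 <= a by rewrite sqrtr_ge0.
have b0 : 0 < b by rewrite sqrtr_gt0 ltr0n.
have a2 : a ^+ 2 = n%:R by rewrite sqr_sqrtr ?ler0n.
have b2 : b ^+ 2 = n%:R + 1 by rewrite sqr_sqrtr ?ler0n// natr1.
(* The sum of the point bounds telescopes: [b - a = 1 / (b + a)] is at least [1 / (2 * b)]. *)
rewrite -lerBrDl ler_pdivrMr//; have : a <= b by rewrite ler_sqrt ?ltr0n// ler_nat.
nra.
Qed.

Lemma avg_collisions n y :
  avg n (fun s => (collisions y s)%:R) <= 297 * n%:R * Num.sqrt n%:R :> R.
Proof.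
have H : avg n (fun s => (collisions y s)%:R) <= n%:R * (1 + 296 * Num.sqrt n%:R) :> R.
  elim: n y => [|n IH] y; first by rewrite /= mul0r.
  rewrite /= ler_pdivrMr ?card_step ?ltr0n//.
  apply: (@le_trans _ _ (\sum_(a : step) n.+1%:R * (1 + 296 * Num.sqrt n.+1%:R))); last first.
    by rewrite sumr_const card_step mulr_natr.
  apply: ler_sum => a _.
  rewrite (avg_eq (g := fun s => 1 + 2 * (visits y (y + vstep a) s)%:R + (collisions (y + vstep a) s)%:R)); last first.
    move=> s _; rewrite -natrM -[1]/(1%:R) -!natrD; congr (_%:R).
  rewrite !avgD avgZ (avg_cst step_gt0).
  have h1 := avg_visits n y (y + vstep a); have h2 := IH (y + vstep a).
  have ab : Num.sqrt n%:R <= Num.sqrt n.+1%:R :> R by rewrite ler_sqrt ?ltr0n// ler_nat.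
  have n0 : 0 <= n%:R :> R by [].
  rewrite -natr1; nra.
apply: le_trans H _; case: n => [|n]; first by rewrite mul0r mulr0 mul0r.
have : 1 <= Num.sqrt n.+1%:R :> R by rewrite -[leLHS]sqrtr1 ler_sqrt ?ltr0n// ler1n.
by rewrite (mulrC 297) -mulrA => h; rewrite ler_wpM2l//; lra.
Qed.

Lemma avg_dy_sqr n : avg n (fun s => (dy s)%:~R ^+ 2) <= n%:R :> R.
Proof.
rewrite -[leRHS]mul1r (avg_eq (g := fun s => (\sum_(a <- s) (vstep a)%:~R) ^+ 2)); last first.
  by move=> s _; rewrite /dy raddf_sum.
apply: (@avg_sqr R step _ n (fun a => (vstep a)%:~R)) => //.
  by rewrite sum_step /= add0r addrN.
by rewrite card_step sum_step /= expr0n /= add0r; lra.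
Qed.

Lemma avg_spread n y :
  avg n (fun s => (spread y y s)%:~R) <= n%:R ^+ 2 :> R.
Proof.
elim: n => [|n IH]; first by rewrite /= expr0n.
rewrite -addn1 avg_cat.
rewrite (avg_eq (g := fun s => (spread y y s)%:~R + (dy s)%:~R ^+ 2)); last first.
  move=> s _; rewrite -[RHS](avg_cst step_gt0 1); apply: avg_eq => -[|a []]// _.
  by rewrite spread_cat /= addr0 addrAC subrr add0r intrD rmorphXn.
rewrite avgD; apply: le_trans (lerD IH (avg_dy_sqr n)) _.
by rewrite addn1 -natrX -natrD -natrX ler_nat; nia.
Qed.

End StepAverages.

(** * Two-step blocks and their exchange *)

Definition block := (step * step)%type.

Definition flat (w : seq block) : seq step := flatten [seq [:: x.1; x.2] | x <- w].

(* The equally likely blocks "two horizontal steps" and "up, down" have the same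
   vertical effect, and their horizontal effects [2 e] and [0] are [e + 1] and
   [e - 1] in some order, where [e] is the orientation of the line. *)
Definition flippable (x : block) : bool :=
  (x == (None, None)) || (x == (Some true, Some false)).

Definition hswap (x : block) : block :=
  if x == (None, None) then (Some true, Some false)
  else if x == (Some true, Some false) then (None, None) else x.

(* replaces both flippable blocks by their mean, one horizontal step *)
Definition halve (w : seq block) : seq step :=
  flatten [seq if flippable x then [:: None] else [:: x.1; x.2] | x <- w].

Lemma hswapK : involutive hswap.
Proof. by case=> -[[]|] [[]|]. Qed.

Lemma flat_cons x w : flat (x :: w) = [:: x.1; x.2] ++ flat w. Proof. by []. Qed.

Lemma halve_cons x w :
  halve (x :: w) = (if flippable x then [:: None] else [:: x.1; x.2]) ++ halve w.
Proof. by []. Qed.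

Lemma flat_cat w w' : flat (w ++ w') = flat w ++ flat w'.
Proof. by rewrite /flat map_cat flatten_cat. Qed.

Lemma halve_cat w w' : halve (w ++ w') = halve w ++ halve w'.
Proof. by rewrite /halve map_cat flatten_cat. Qed.

Lemma size_flat w : size (flat w) = (size w).*2.
Proof. by elim: w => //= x w ->; rewrite doubleS. Qed.

Lemma dy_flip c w : size c = size w -> dy (flat (flip hswap c w)) = dy (flat w).
Proof.
elim: w c => [|x w IH] [|b c]//= [cw].
by rewrite !dy_cons [in LHS]IH// !addrA; congr (_ + _); case: b; case: x => -[[]|] [[]|].
Qed.

(** The horizontal step replacing a flippable block is taken at the height where the block starts,
    which the full word visits as well. Line counts of the halved word are thus controlled by
    visits, whose moments are known. *)
Lemma hsteps_halve z y w : (hsteps z y (halve w) <= visits z y (flat w))%N.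
Proof.
elim: w y => // x w IH y.
rewrite flat_cons visits_cat /halve [flatten _]/= hsteps_cat -/(halve w).
have -> : dy (if flippable x then [:: None] else [:: x.1; x.2]) = dy [:: x.1; x.2].
  by case: x => -[[]|] [[]|]; rewrite /= /dy ?big_cons big_nil.
apply: leq_add (IH _); case: (boolP (flippable x)) => [fx|_]; last exact: hsteps_le_visits.
by move: fx; case: x => -[[]|] [[]|] //= _; rewrite ?addn0 leq_addr.
Qed.

Lemma count_halve w : (count flippable w <= count_mem None (halve w))%N.
Proof.
elim: w => //= x w IH; rewrite /halve /= count_cat -/(halve w) leq_add//.
by case: (flippable x).
Qed.

Lemma size_halve w : (size (halve w) <= (size w).*2)%N.
Proof.
elim: w => //= x w IH; rewrite /halve /= size_cat -/(halve w) doubleS.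
by case: (flippable x) => /=; lia.
Qed.

Lemma card_block : #|{: block}| = 9%N.
Proof. by rewrite card_prod card_step. Qed.

Lemma card_flippable : #|flippable : pred block| = 2%N.
Proof.
rewrite (eq_card (B := [set ((None, None) : block); (Some true, Some false)])); last first.
  by move=> x; rewrite !inE.
by rewrite cards2.
Qed.

Lemma avg_flat (R : realFieldType) m (f : seq step -> R) :
  avg m (fun w : seq block => f (flat w)) = avg m.*2 f.
Proof.
elim: m f => [|m IH] f //; rewrite doubleS /= card_block card_step.
rewrite (eq_bigr (fun x : block => avg m.*2 (fun s => f [:: x.1, x.2 & s]))); last first.
  by move=> x _; rewrite -[RHS]IH.
rewrite -(pair_bigA _ (fun a b => avg m.*2 (fun s => f [:: a, b & s])))/=.
by rewrite -mulr_suml -mulrA -invfM -natrM.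
Qed.

(* Resampling the flippable blocks adds to the displacement of [halve w] a simple
   random walk that does not depend on the environment. *)
Lemma avg_hswap (R : rcfType) beta y (w : seq block) (phi : int -> R) :
  avg (size w) (fun c => phi (dx beta y (flat (flip hswap c w)))) =
  avg (count flippable w) (fun c => phi (dx beta y (halve w) + srw c)).
Proof.
elim: w y phi => [|x w IH] y phi; first by rewrite /= /srw big_nil.
rewrite [size _]/= avg_boolS.
pose y' := y + dy [:: x.1; x.2]; pose xb (b : bool) := if b then hswap x else x.
have E b : avg (size w) (fun c => phi (dx beta y (flat (flip hswap (b :: c) (x :: w))))) =
    avg (count flippable w) (fun c => phi (dx beta y [:: (xb b).1; (xb b).2] + (dx beta y' (halve w) + srw c))).
  rewrite -[RHS](IH y' (fun z => phi (_ + z))); apply: avg_eq => c _.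
  rewrite -[flip hswap (b :: c) (x :: w)]/(xb b :: flip hswap c w).
  rewrite flat_cons dx_cat.
  have -> // : dy [:: (xb b).1; (xb b).2] = dy [:: x.1; x.2].
  by rewrite /xb /dy !big_cons big_nil; case: b => //; move: (x); case=> -[[]|] [[]|].
rewrite !E halve_cons [in RHS]dx_cat -[count _ (x :: w)]/(flippable x + count flippable w)%N.
have [fx|fx] := boolP (flippable x); last first.
  have hx : hswap x = x by move: (x) fx => -[[[]|] [[]|]].
  rewrite [xb true]hx -mulr2n -[X in X / _]mulr_natr mulfK ?pnatr_eq0//.
  by apply: avg_eq => c _; rewrite addrA.
rewrite add1n avg_boolS.
have -> : y + dy [:: None] = y'.
  by rewrite /y' /dy !big_cons big_nil; move: (x) fx => -[[[]|] [[]|]].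
have F e : avg (count flippable w) (fun c => phi (dx beta y [:: None] + dx beta y' (halve w) + srw (e :: c)))
   = avg (count flippable w) (fun c => phi (sg (beta y) + sg e + (dx beta y' (halve w) + srw c))).
  by apply: avg_eq => c _; rewrite srw_cons /= addr0; congr phi; ring.
rewrite !F.
have G : (dx beta y [:: (hswap x).1; (hswap x).2] = sg (beta y) + sg (beta y) /\
   dx beta y [:: x.1; x.2] = 0) \/ (dx beta y [:: (hswap x).1; (hswap x).2] = 0 /\
   dx beta y [:: x.1; x.2] = sg (beta y) + sg (beta y)).
  by case: (orP fx) => /eqP ->; [right|left]; rewrite /= ?addr0.
by case: G => -[-> ->]; case: (beta y); rewrite // [in LHS]addrC.
Qed.

(** * The annealed return probability *)

Lemma sqr_sum_le_card (R : rcfType) (I : finType) (H : {set I}) (v : I -> R) :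
  (\sum_(i in H) v i) ^+ 2 <= #|H|%:R * \sum_(i in H) v i ^+ 2.
Proof.
set S := \sum_(i in H) v i; set Q := \sum_(i in H) _; set k : R := #|H|%:R.
have [H0|H0] := posnP #|H|.
  by rewrite /k H0 mul0r /S (cards0_eq H0) big_set0 expr0n.
have k0 : 0 < k by rewrite ltr0n.
have : 0 <= \sum_(i in H) (k * v i - S) ^+ 2 by apply: sumr_ge0 => i _; rewrite sqr_ge0.
rewrite (eq_bigr (fun i => k ^+ 2 * v i ^+ 2 + (- 2 * k * S) * v i + S ^+ 2)); last first.
  by move=> i _; ring.
rewrite !big_split/= -!mulr_sumr sumr_const -/S -/Q -[_ *+ #|H|]mulr_natr -/k => h.
by rewrite -(ler_pM2l k0); nra.
Qed.

Section Heavy.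
Variables (R : rcfType) (n : nat) (y0 : int) (w : seq block).
Hypothesis wn : ((size w).*2 <= n)%N.

Let h := size w.
Let lev := @level n y0.
Let hor i := hsteps (lev i) y0 (halve w).
Let vis i := visits (lev i) y0 (flat w).

Lemma card_near (D : R) : 1 <= D -> #|[set i | `|lev i - y0|%:~R <= D]|%:R <= 3 * D.
Proof.
move=> D1.
set N := [set i | _].
have [H0|[j0 j0N]] := set_0Vmem N; first by rewrite H0 cards0; lra.
(* The farthest near level provides an integer radius [k <= D], so at most [2k + 1 <= 3 * D] levels
   are near. *)
have [j jN jmax] := @arg_maxnP _ j0 (mem N) (fun i => absz (lev i - y0)) j0N.
have jD : `|lev j - y0|%:~R <= D by move: jN; rewrite [_ j]inE.
pose k := absz (lev j - y0).
have kD : k%:R <= D by rewrite -[k%:R]/(k%:Z%:~R) abszE.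
apply: (@le_trans _ _ (k.*2.+1)%:R); last first.
  by rewrite -addn1 natrD -muln2 natrM; lra.
rewrite ler_nat -[X in (_ <= X)%N]card_ord.
pose f (i : 'I_n.*2.+1) : 'I_k.*2.+1 := inord (absz (lev i - y0 + k%:Z)).
rewrite -(card_in_imset (f := f)) ?max_card// => i i' /jmax hi /jmax hi' /(congr1 val).
rewrite -/k in hi hi'; rewrite /f /= !inordK; [|lia|lia].
by move=> e; apply: (@level_inj n y0); rewrite /lev in hi hi' e *; lia.
Qed.

(* Few visits far away and few on light lines leave many visits to heavy lines,
   and by Cauchy-Schwarz the collisions bound the concentration of those. *)
Lemma card_heavy (D V L : R) :
  1 <= D -> 0 < V -> 0 <= L -> L * D * 72 <= h%:R ->
  (h <= 9 * count flippable w)%N ->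
  (spread y0 y0 (flat w))%:~R * 36 <= D ^+ 2 * h%:R ->
  (collisions y0 (flat w))%:R <= V ->
  (h%:R / 24) ^+ 2 <= #|[set i | L <= (hor i)%:R]|%:R * V.
Proof.
move=> D1 V0 L0 LD rh sp co.
have D0 : 0 < D by apply: lt_le_trans D1.
set H := [set i | _].
have win : `|y0 - y0| + (size (flat w))%:Z <= n%:Z by rewrite size_flat; lia.
have win' : `|y0 - y0| + (size (halve w))%:Z <= n%:Z.
  by have := size_halve w; lia.
have hv i : (hor i)%:R <= (vis i)%:R :> R by rewrite ler_nat hsteps_halve.
pose N := [set i | `|lev i - y0|%:~R <= D].
have tot : h%:R / 9 <= \sum_i (hor i)%:R :> R.
  rewrite ler_pdivrMr// -natr_sum sum_hsteps// -natrM ler_nat.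
  by have := count_halve w; lia.
have far : \sum_(i | i \notin N) (vis i)%:R <= h%:R / 36 :> R.
  have D20 : 0 < D ^+ 2 by rewrite exprn_gt0.
  rewrite -(ler_pM2l D20); apply: (@le_trans _ _ (spread y0 y0 (flat w))%:~R); last by lra.
  rewrite -(sum_visits_sqr win) raddf_sum/= mulr_sumr.
  apply: (@le_trans _ _ (\sum_(i | i \notin N) ((vis i)%:Z * (lev i - y0) ^+ 2)%:~R)).
    apply: ler_sum => i; rewrite inE -ltNge => hi.
    rewrite intrM mulrC ler_wpM2l// -(real_normK (num_real (lev i - y0))) rmorphXn/=.
    by rewrite lerXn2r ?nnegrE ?(ltW D0) ?(ltW hi)// ler0z.
  rewrite [leRHS](bigID (fun i => i \in N))/= lerDr sumr_ge0// => i _.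
  by rewrite ler0z mulr_ge0// sqr_ge0.
(* Of at least [h / 9] horizontal steps, [h / 36] may be lost far away and [h / 24] on light lines
   nearby; [1/9 - 1/36 - 1/24 = 1/24]. *)
have main : h%:R / 24 <= \sum_(i in H) (vis i)%:R :> R.
  have split : \sum_i (hor i)%:R <= \sum_(i in H) (vis i)%:R
      + (\sum_(i in N) L + \sum_(i | i \notin N) (vis i)%:R).
    rewrite [leLHS](bigID (fun i => i \in H))/= lerD// ?ler_sum//.
    rewrite [leLHS](bigID (fun i => i \in N))/= lerD//.
      rewrite [leRHS](bigID (fun i => i \in H))/= -[leLHS]add0r lerD ?sumr_ge0//.
      rewrite (eq_bigl (fun i => (i \in N) && (i \notin H))); last by move=> i; rewrite andbC.
      by apply: ler_sum => i /andP[_]; rewrite inE -ltNge => /ltW.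
    rewrite [leRHS](bigID (fun i => i \in H))/= -[leLHS]add0r lerD ?sumr_ge0//.
    rewrite (eq_bigl (fun i => (i \notin N) && (i \notin H))); last by move=> i; rewrite andbC.
    by apply: ler_sum.
  have near : \sum_(i in N) L <= h%:R / 24.
    rewrite sumr_const -[leLHS]mulr_natl.
    apply: (@le_trans _ _ (3 * D * L)); last by lra.
    by rewrite ler_wpM2r// card_near.
  lra.
apply: (@le_trans _ _ ((\sum_(i in H) (vis i)%:R) ^+ 2)).
  by rewrite lerXn2r// ?nnegrE ?sumr_ge0// divr_ge0.
apply: le_trans (sqr_sum_le_card _ _) _.
rewrite ler_wpM2l//; apply: le_trans co; rewrite -(sum_sqr_visits win) natr_sum.
rewrite [leRHS](bigID (fun i => i \in H))/= -[leLHS]addr0 lerD ?sumr_ge0//.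
by apply: ler_sum => i _; rewrite natrX.
Qed.

End Heavy.

Section ConditionalBound.
Variables (R : rcfType) (I : finType) (a : I -> int) (c : int).

Lemma srw_point_shift r z z' :
  avg r (fun s => (z + srw s == z')%:R) <= (Num.sqrt r.+1%:R)^-1 :> R.
Proof.
apply: le_trans (srw_point R r (z' - z)); apply: avg_le => s _.
by rewrite [srw s == _]eq_sym subr_eq eq_sym addrC.
Qed.

(** Conditional probability of the horizontal displacement [c], given the line counts [a] of the
    halved word and its number [r] of flippable blocks. *)
Definition hit r : R :=
  setavg (fun A => avg r (fun s => (sgsum a A + srw s == c)%:R)).

Lemma hit_le1 r : hit r <= 1.
Proof.
rewrite /hit; apply: setavg_le_cst => A; apply: avg_le_cst => [|s _].
  by rewrite card_bool.
by case: (_ == _).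
Qed.

Lemma hit_le r1 r2 r3 :
  hit (r1 + (r2 + r3)) <= (Num.sqrt r2.+1%:R)^-1.
Proof.
have b0 : (0 < #|{: bool}|)%N by rewrite card_bool.
apply: setavg_le_cst => A; rewrite avg_cat; apply: avg_le_cst => // s1 _.
rewrite avg_cat avg_exchange; apply: avg_le_cst => // s3 _.
apply: le_trans (srw_point_shift r2 (sgsum a A + srw s1 + srw s3) c).
by apply: avg_le => s2 _; rewrite !srw_cat !addrA (addrAC _ (srw s2)).
Qed.

(* With [W], [R1], [R2], [R3] the environment part and the three pieces of the
   walk, [W + R1 + R2 + R3 = c] forces [|W + R1 + R3 - c| <= t] or [|R2| > t];
   the point bound is applied to [R2] in the first case and to [R1] in the
   second, where the second moment of [R2] gives the remaining factor. *)
Lemma hit_le_good (r1 r2 r3 q : nat) (H : {set I}) (L t : R) :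
  0 < L -> {in H, forall i, L <= (a i)%:~R} -> 0 < t -> t < q%:R * L ->
  hit (r1 + (r2 + r3)) <=
    (Num.sqrt r2.+1%:R)^-1 * (q%:R / Num.sqrt #|H|.+1%:R)
    + (Num.sqrt r1.+1%:R)^-1 * (r2%:R / t ^+ 2).
Proof.
move=> L0 aL t0 tq; have b0 : (0 < #|{: bool}|)%N by rewrite card_bool.
pose e A s1 s2 s3 : R := (sgsum a A + srw s1 + srw s2 + srw s3 == c)%:R.
pose g A s1 s3 : R := (`|(sgsum a A)%:~R - (c - srw s1 - srw s3)%:~R| <= t)%R%:R.
have -> : hit (r1 + (r2 + r3)) =
    setavg (fun A => avg r1 (fun s1 => avg r2 (fun s2 => avg r3 (e A s1 s2)))).
  apply: setavg_eq => A; rewrite avg_cat; apply: avg_eq => s1 _.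
  rewrite avg_cat; apply: avg_eq => s2 _; apply: avg_eq => s3 _.
  by rewrite /e !srw_cat !addrA.
apply: (@le_trans _ _ (setavg (fun A => avg r1 (fun s1 => avg r2 (fun s2 => avg r3
    (fun s3 => g A s1 s3 * e A s1 s2 s3 + ((srw s2)%:~R ^+ 2 / t ^+ 2) * e A s1 s2 s3)))))).
  apply: setavg_le => A; apply: avg_le => s1 _; apply: avg_le => s2 _; apply: avg_le => s3 _.
  rewrite -mulrDl /e; case: eqP => [h|_]; last by rewrite !mulr0.
  rewrite !mulr1 /g; case: (lerP `|_| t) => [_|lt] /=; first by rewrite lerDl divr_ge0 ?sqr_ge0.
  rewrite add0r ler_pdivlMr ?exprn_gt0// mul1r.
  move: lt; rewrite -intrB -intr_norm => lt.
  rewrite -[leRHS](real_normK (num_real _)) -intr_norm.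
  rewrite lerXn2r// ?nnegrE ?(ltW t0)//; apply: le_trans (ltW lt) _.
  rewrite ler_int; lia.
rewrite [leLHS](_ : _ =
   setavg (fun A => avg r1 (fun s1 => avg r3 (fun s3 => g A s1 s3 * avg r2 (fun s2 => e A s1 s2 s3)))) +
   setavg (fun A => avg r2 (fun s2 => ((srw s2)%:~R ^+ 2 / t ^+ 2) * avg r3 (fun s3 => avg r1 (fun s1 => e A s1 s2 s3))))); last first.
  rewrite -setavgD; apply: setavg_eq => A.
  rewrite [X in _ = _ + X](_ : _ = avg r1 (fun s1 => avg r2 (fun s2 => (srw s2)%:~R ^+ 2 / t ^+ 2 *
    avg r3 (fun s3 => e A s1 s2 s3)))); last first.
    rewrite [RHS]avg_exchange; apply: avg_eq => s2 _; rewrite avgZ; congr (_ * _).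
    by rewrite avg_exchange.
  rewrite -avgD; apply: avg_eq => s1 _.
  rewrite [X in _ = X + _](_ : _ = avg r2 (fun s2 => avg r3 (fun s3 => g A s1 s3 * e A s1 s2 s3))); last first.
    by rewrite [RHS]avg_exchange; apply: avg_eq => s3 _; rewrite avgZ.
  by rewrite -avgD; apply: avg_eq => s2 _; rewrite -avgZ -avgD.
apply: lerD.
  apply: (@le_trans _ _ (setavg (fun A => avg r1 (fun s1 => avg r3 (fun s3 => (Num.sqrt r2.+1%:R)^-1 * g A s1 s3))))).
    apply: setavg_le => A; apply: avg_le => s _; apply: avg_le => s0 _; rewrite mulrC ler_wpM2r ?ler0n//.
    apply: le_trans (srw_point_shift r2 (sgsum a A + srw s + srw s0) c).
    by apply: avg_le => s2 _; rewrite /e (addrAC _ (srw s2)).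
  rewrite setavg_avg; apply: avg_le_cst => // s1 _.
  rewrite setavg_avg; apply: avg_le_cst => // s3 _.
  rewrite setavgZ ler_wpM2l ?invr_ge0 ?sqrtr_ge0//.
  exact: (@littlewood_offord_window R I a H L).
apply: setavg_le_cst => A.
apply: (@le_trans _ _ (avg r2 (fun s2 => (srw s2)%:~R ^+ 2 * (t ^- 2 * (Num.sqrt r1.+1%:R)^-1)))).
  apply: avg_le => s2 _; rewrite mulrA ler_wpM2l ?divr_ge0 ?sqr_ge0//.
  apply: avg_le_cst => // s3 _.
  apply: le_trans (srw_point_shift r1 (sgsum a A + srw s2 + srw s3) c).
  by apply: avg_le => s1 _; rewrite /e -!addrA [srw s1 + _]addrC !addrA.
rewrite avgZr [leRHS]mulrC -mulrA ler_wpM2r ?mulr_ge0 ?invr_ge0 ?sqrtr_ge0 ?sqr_ge0//.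
exact: srw_sqr.
Qed.

End ConditionalBound.

(** [74] comes from the vertical point bound [dy_point]. The other factor is
    [26175 = 2 * 648 + 20883 + 3996]: the two pieces with few flippable blocks, the good case [K],
    and the Markov bounds on spread and collisions. *)
Definition return_const (R : realType) : R := 74 * (75 * 349).

Section ReturnBound.
Variables (R : realType) (n : nat) (y0 : int).
Local Notation I := ('I_n.*2.+1).

(** Lines outside the window are given the value [false]; words of length at most [n] from [y0]
    never read them. *)
Definition env (A : {set I}) (z : int) : bool :=
  [exists i, (level y0 i == z) && (i \in A)].

Lemma envK A : [set i | env A (level y0 i)] = A.
Proof.
apply/setP => i; rewrite inE; apply/existsP/idP => [[j /andP[/eqP/level_inj ->]]//|iA].
by exists i; rewrite eqxx.
Qed.

Definition hvec (s : seq step) (i : I) : int := (hsteps (level y0 i) y0 s)%:Z.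

Lemma dx_env A s : (size s <= n)%N -> dx (env A) y0 s = sgsum (hvec s) A.
Proof. by move=> sn; rewrite (@dx_sgsum n y0) ?envK//; lia. Qed.

Let b0 : (0 < #|{: block}|)%N. Proof. by rewrite card_block. Qed.

(** Exchanging flippable blocks preserves [dy], so the vertical indicator factors out. The
    environment is then averaged inside the word average, so that the line counts are fixed weights
    when Littlewood-Offord is applied. *)
Lemma hit_blocks m c d : (m.*2 <= n)%N ->
  setavg (fun A => avg m.*2 (fun s =>
    ((sgsum (hvec s) A == c) && (dy s == d))%:R)) =
  avg m (fun w => (dy (flat w) == d)%:R * hit R (hvec (halve w)) c (count flippable w)) :> R.
Proof.
move=> mn.
transitivity (setavg (fun A => avg m (fun w => (dy (flat w) == d)%:R *
    avg (count flippable w) (fun s => (sgsum (hvec (halve w)) A + srw s == c)%:R))) : R).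
  apply: setavg_eq => A; rewrite -avg_flat (avg_flip _ _ hswapK).
  apply: avg_eq => w wm; have sw : (size (halve w) <= n)%N by rewrite (leq_trans (size_halve w))// wm.
  rewrite -(dx_env A sw) -[RHS]mulr1.
  rewrite -(avg_hswap (env A) y0 w (fun z => (z == c)%:R)) wm mulr1 -avgZ.
  apply: avg_eq => s sm; rewrite dy_flip ?sm ?wm// -dx_env; last first.
    by rewrite size_flat /flip size_map size_zip sm wm minnn.
  by rewrite -mulnb natrM mulrC.
by rewrite setavg_avg; apply: avg_eq => w _; rewrite setavgZ.
Qed.

Section Scale.
Variables (h : nat) (x : R).
Hypotheses (h0 : (0 < h)%N) (x0 : 0 < x) (xh : x ^+ 16 = h.+1%:R).

Let x1 : 1 <= x.
Proof. by rewrite -(@expr_ge1 _ 16) ?(ltW x0)// xh ler1n. Qed.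

Let hx : x ^+ 16 <= 2 * h%:R.
Proof. by rewrite xh -natrM ler_nat; lia. Qed.

Let hx' : h%:R <= x ^+ 16.
Proof. by rewrite xh ler_nat. Qed.

Let inv_sqrt_le (r k : nat) (z : R) : (0 < z) -> z ^+ 2 <= k%:R ^+ 2 * r.+1%:R ->
  (Num.sqrt r.+1%:R)^-1 <= k%:R / z.
Proof.
move=> z0 hz; rewrite ler_pdivlMr// mulrC ler_pdivrMr ?sqrtr_gt0 ?ltr0n//.
rewrite -(@ler_pXn2r _ 2)// ?nnegrE ?mulr_ge0 ?sqrtr_ge0 ?ler0n ?(ltW z0)//.
by rewrite exprMn sqr_sqrtr ?ler0n.
Qed.

Let few (w : seq block) : R :=
  (2 * #|{: block}| * count flippable w < #|flippable : pred block| * h)%N%:R.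

Let sprd (w : seq block) : R := (spread y0 y0 (flat w))%:~R.
Let coll (w : seq block) : R := (collisions y0 (flat w))%:R.

Let sprd_ge0 w : 0 <= sprd w.
Proof.
rewrite /sprd ler0z; elim: (flat w) {2}y0 => //= a s IH y.
by rewrite addr_ge0 ?sqr_ge0.
Qed.

Let tail_ge0 w : 0 <= 36 / (h%:R * x ^+ 18) * sprd w + coll w * x ^- 26.
Proof.
have xn k : 0 < x ^+ k by rewrite exprn_gt0.
have h18 : 0 < h%:R * x ^+ 18 by rewrite mulr_gt0 ?ltr0n.
by apply: addr_ge0; apply: mulr_ge0; rewrite ?sprd_ge0 ?ler0n// ltW ?invr_gt0// divr_gt0.
Qed.

(** In [hit_le_good], the point bounds give [3 * x ^- 8], the number of windows is at most
    [145 * x ^+ 2], the heavy lines give [48 * x ^- 3], and the second-moment term contributes the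
    final [1], times [x ^- 1]. *)
Let K : R := 3 * (145 * 48 + 1).

Let K_ge0 : 0 <= K. Proof. by rewrite /K; lra. Qed.

(* At the scale [x = (h+1)^(1/16)], [hit_le_good] and [card_heavy] are used with
   [t = D = x^9], [V = x^26] and [L = h / (72 x^9)]. *)
Lemma hit_scale c w1 w2 w3 : size w1 = h -> size w2 = h ->
  ((size (w1 ++ (w2 ++ w3))).*2 <= n)%N ->
  hit R (hvec (halve (w1 ++ (w2 ++ w3)))) c (count flippable (w1 ++ (w2 ++ w3)))
  <= few w1 + few w2 + K * x ^- 9 +
     3 * x ^- 8 * (36 / (h%:R * x ^+ 18) * sprd w1 + coll w1 * x ^- 26).
Proof.
move=> s1 s2 wn; set w := w1 ++ _; rewrite !count_cat.
have hR : 0 < h%:R :> R by rewrite ltr0n.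
have xn k : 0 < x ^+ k by rewrite exprn_gt0.
have xV k : 0 < x ^- k by rewrite invr_gt0.
have hx18 : 0 < h%:R * x ^+ 18 by rewrite mulr_gt0.
have sp0 := sprd_ge0 w1; have tail0 := tail_ge0 w1.
have x8 : 0 < x ^- 8 by [].
have x9 : 0 < x ^- 9 by [].
have few0 u : 0 <= few u by [].
have Kx9 : 0 <= K * x ^- 9 by rewrite mulr_ge0 ?(ltW x9).
set T := 3 * x ^- 8 * (_ + _); have T0 : 0 <= T by rewrite mulr_ge0// mulr_ge0// ltW.
have [f1|f1] := boolP (2 * #|{: block}| * count flippable w1 < #|flippable : pred block| * h)%N.
  apply: le_trans (hit_le1 _ _ _ _) _; have := few0 w2.
  have -> : few w1 = 1 by rewrite /few f1.
  lra.
have [f2|f2] := boolP (2 * #|{: block}| * count flippable w2 < #|flippable : pred block| * h)%N.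
  apply: le_trans (hit_le1 _ _ _ _) _; have := few0 w1.
  have -> : few w2 = 1 by rewrite /few f2.
  lra.
rewrite /few (negbTE f1) (negbTE f2) !add0r.
rewrite -leqNgt card_block card_flippable in f1.
rewrite -leqNgt card_block card_flippable in f2.
set r1 := count _ w1 in f1 *; set r2 := count _ w2 in f2 *; set r3 := count _ w3.
have q8 r : (2 * h <= 2 * 9 * r)%N -> (Num.sqrt r.+1%:R)^-1 <= 3 * x ^- 8 :> R.
  move=> hr; apply: inv_sqrt_le => //.
  by rewrite -exprM xh -natrX -natrM ler_nat; move: hr; clear; lia.
have q1 := q8 _ f1; have q2 := q8 _ f2.
(* Scarcity of flippable blocks averages to [O(x^-16)], so the trivial bound was enough above.
   Excess collisions or spread are only excluded up to [O(x^-2)] by Markov's inequality, so the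
   factor [x ^- 8] of the second piece must be kept. *)
have [co|co] := ltP (x ^+ 26) (coll w1).
  apply: le_trans (hit_le _ _ _ _ _ _) _; apply: le_trans q2 _.
  apply: (@le_trans _ _ T); last first.
    by rewrite lerDr.
  rewrite /T ler_peMr ?mulr_ge0 ?(ltW x8)// -[leLHS]add0r lerD//.
    by rewrite mulr_ge0// divr_ge0// mulr_ge0 ?ler0n ?exprn_ge0 ?ltW.
  by rewrite ler_pdivlMr// mul1r ltW.
have [sp|sp] := ltP (h%:R * x ^+ 18) (36 * sprd w1).
  apply: le_trans (hit_le _ _ _ _ _ _) _; apply: le_trans q2 _.
  apply: (@le_trans _ _ T); last first.
    by rewrite lerDr.
  rewrite /T ler_peMr ?mulr_ge0 ?(ltW x8)// -[leLHS]addr0 lerD//; last first.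
    by rewrite mulr_ge0 ?ler0n// invr_ge0 ltW.
  by rewrite mulrAC ler_pdivlMr ?mulr_gt0// mul1r ltW.
(* [t] slightly exceeds the typical size [x ^ 8] of the second piece of the simple walk; [L] is the
   largest weight that [card_heavy] allows for [D = t]. *)
pose t := x ^+ 9; pose L := h%:R / (72 * t).
have t0 : 0 < t by exact: xn.
have L0 : 0 < L by rewrite divr_gt0// mulr_gt0.
pose H := [set i : I | L <= (hsteps (level y0 i) y0 (halve w1))%:R].
have HV : (h%:R / 24) ^+ 2 <= #|H|%:R * x ^+ 26.
  rewrite /H -s1; apply: (@card_heavy R n y0 w1 _ t (x ^+ 26) L).
  - by apply: leq_trans wn; rewrite leq_double size_cat leq_addr.
  - exact: exprn_ege1.
  - exact: xn.
  - exact: ltW.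
  - by rewrite /L s1 [leLHS](_ : _ = h%:R)//; field; rewrite gt_eqF.
  - by rewrite s1 -/r1; move: f1; clear; lia.
  - by rewrite s1 /t -exprM mulrC [leRHS]mulrC.
  - exact: co.
have HL : {in H, forall i, L <= (hvec (halve w) i)%:~R}.
  move=> i; rewrite inE => /le_trans; apply.
  by rewrite /hvec /w halve_cat hsteps_cat -[leRHS]/(_%:R) ler_nat leq_addr.
have tL : t / L <= 144 * x ^+ 2.
  rewrite ler_pdivrMr// /L mulrA ler_pdivlMr ?mulr_gt0//.
  rewrite [leLHS](_ : _ = 72 * x ^+ 2 * x ^+ 16); last by rewrite /t; ring.
  have := hx; have := xn 2%N; nra.
pose q := (Num.truncn (t / L)).+1.
have /andP[qlo qhi] : (Num.truncn (t / L))%:R <= t / L < q%:R.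
  by rewrite truncn_itv// divr_ge0 ?ltW.
have tq : t < q%:R * L by rewrite -ltr_pdivrMr.
have qx : q%:R <= 145 * x ^+ 2 :> R.
  rewrite /q -natr1; have := exprn_ege1 2 x1; lra.
apply: le_trans (hit_le_good _ _ _ _ L0 HL t0 tq) _.
apply: (@le_trans _ _ (K * x ^- 9)); last by rewrite lerDl.
have K3 : (Num.sqrt #|H|.+1%:R)^-1 <= 48 * x ^- 3 :> R.
  apply: inv_sqrt_le => //; rewrite -(ler_pM2r (xn 26%N)).
  have := HV; have := hx; have := xn 26%N; have := xn 16%N.
  rewrite -natr1 -[x ^+ 3 ^+ 2 * _](_ : (x ^+ 16) ^+ 2 = _); last by ring.
  set u := x ^+ 16; set v := x ^+ 26; set k := #|H|%:R; nra.
rewrite (_ : K * x ^- 9 = 3 * x ^- 8 * (145 * x ^+ 2 * (48 * x ^- 3)) + 3 * x ^- 8 * x ^- 1); last first.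
  by rewrite /K; field; rewrite gt_eqF.
apply: lerD.
  apply: ler_pM => //; rewrite ?invr_ge0 ?divr_ge0 ?mulr_ge0 ?sqrtr_ge0//.
  by apply: ler_pM; rewrite ?invr_ge0 ?sqrtr_ge0.
apply: ler_pM => //; rewrite ?invr_ge0 ?divr_ge0 ?sqrtr_ge0 ?exprn_ge0 ?(ltW t0) ?(ltW x0)//.
have r2h : r2%:R <= x ^+ 16 by apply: le_trans hx'; rewrite ler_nat -s2 count_size.
rewrite ler_pdivrMr ?exprn_gt0//; apply: (le_trans r2h).
rewrite [leRHS](_ : _ = x ^+ 16 * x); last by rewrite /t; field; rewrite gt_eqF.
by rewrite ler_peMr// ltW.
Qed.

(* The third piece of the word is only used for the vertical return, a factor
   [O(x^-8)] independent of the first two pieces. *)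
Lemma return_scale c d l : (h <= l)%N -> ((h + (h + l)).*2 <= n)%N ->
  setavg (fun A => avg (h + (h + l)).*2 (fun s =>
    ((sgsum (hvec s) A == c) && (dy s == d))%:R)) <= return_const R * x ^- 17.
Proof.
move=> hl hn; rewrite hit_blocks//.
have hR : 0 < h%:R :> R by rewrite ltr0n.
have xV k : 0 < x ^- k by rewrite invr_gt0 exprn_gt0.
pose Phi w1 w2 : R := few w1 + few w2 + K * x ^- 9 +
     3 * x ^- 8 * (36 / (h%:R * x ^+ 18) * sprd w1 + coll w1 * x ^- 26).
pose q : R := 74 * x ^- 8.
apply: (@le_trans _ _ (avg h (fun w1 => avg h (fun w2 => Phi w1 w2 * q)))).
  rewrite avg_cat; apply: avg_le => w1 s1; rewrite avg_cat; apply: avg_le => w2 s2.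
  apply: (@le_trans _ _ (avg l (fun w3 => Phi w1 w2 * (dy (flat w3) == d - dy (flat w1) - dy (flat w2))%:R))).
    apply: avg_le => w3 s3; rewrite !flat_cat !dy_cat mulrC.
    rewrite (_ : (_ == d) = (dy (flat w3) == d - dy (flat w1) - dy (flat w2))); last first.
      by rewrite eq_sym [RHS]eq_sym !subr_eq; congr (_ == _); ring.
    by rewrite ler_wpM2r//; apply: hit_scale; rewrite // !size_cat s1 s2 s3.
  rewrite avgZ ler_wpM2l//.
    apply: addr_ge0; last by rewrite mulr_ge0 ?tail_ge0// mulr_ge0// ltW.
    by rewrite !addr_ge0 ?ler0n// mulr_ge0 ?(ltW (xV 9%N)).
  rewrite (avg_flat l (fun s => (dy s == _)%:R)); apply: le_trans (dy_point _ _ _) _.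
  rewrite /q ler_wpM2l// lef_pV2 ?posrE ?exprn_gt0 ?sqrtr_gt0 ?ltr0n//.
  rewrite -(@ler_pXn2r _ 2)// ?nnegrE ?exprn_ge0 ?sqrtr_ge0 ?(ltW x0)//.
  by rewrite sqr_sqrtr// -exprM xh ler_nat; lia.
have Efew : avg h few <= 648 * x ^- 16.
  apply: le_trans (avg_count_lt R b0 _ _) _; first by rewrite card_flippable.
  rewrite card_block ler_pdivrMr// mulrAC ler_pdivlMr ?exprn_gt0//.
  have := hx; lra.
have Esp : avg h sprd <= 4 * h%:R ^+ 2.
  rewrite /sprd (avg_flat h (fun s => (spread y0 y0 s)%:~R)).
  apply: le_trans (avg_spread R _ _) _.
  by rewrite -muln2 natrM exprMn mulrC; lra.
have Eco : avg h coll <= 1188 * x ^+ 24.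
  rewrite /coll (avg_flat h (fun s => (collisions y0 s)%:R)).
  apply: le_trans (avg_collisions R _ _) _.
  have sq : Num.sqrt (h.*2)%:R <= 2 * x ^+ 8 :> R.
    rewrite -(@ler_pXn2r _ 2)// ?nnegrE ?mulr_ge0 ?exprn_ge0 ?sqrtr_ge0 ?(ltW x0)//.
    by rewrite sqr_sqrtr// exprMn -exprM xh -muln2 natrM -natr1; have := hR; lra.
  have h2 : (h.*2)%:R <= 2 * x ^+ 16 :> R.
    by rewrite -muln2 natrM; have := hx'; lra.
  rewrite [leRHS](_ : _ = 297 * (2 * x ^+ 16) * (2 * x ^+ 8)); last by ring.
  rewrite -mulrA -[leRHS]mulrA ler_wpM2l ?ler0n//.
  by apply: ler_pM; rewrite ?ler0n ?sqrtr_ge0.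
have E1 w1 : avg h (fun w2 => Phi w1 w2 * q) <= q * (few w1 + 648 * x ^- 16
    + K * x ^- 9 + 3 * x ^- 8 * (36 / (h%:R * x ^+ 18) * sprd w1 + coll w1 * x ^- 26)).
  rewrite avgZr mulrC ler_wpM2l ?mulr_ge0 ?(ltW (xV 8%N))//.
  rewrite /Phi (avg_eq (g := fun w2 => few w2 + (few w1 + K * x ^- 9 +
     3 * x ^- 8 * (36 / (h%:R * x ^+ 18) * sprd w1 + coll w1 * x ^- 26)))); last first.
    by move=> w2 _; ring.
  rewrite avgD (avg_cst b0).
  set T := 3 * x ^- 8 * _; set u := K * _; move: Efew; set v := 648 * _; lra.
apply: le_trans (avg_le (fun w1 _ => E1 w1)) _.
rewrite avgZ.
rewrite (avg_eq (g := fun w1 => few w1 + ((648 * x ^- 16 + K * x ^- 9) +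
   3 * x ^- 8 * (36 / (h%:R * x ^+ 18) * sprd w1 + x ^- 26 * coll w1)))); last first.
  by move=> w1 _; ring.
rewrite !avgD !(avg_cst b0) avgZ avgD !avgZ.
have b16 : x ^- 16 <= x ^- 9.
  by rewrite lef_pV2 ?posrE ?exprn_gt0// ler_weXn2l.
have b2 : x ^- 2 <= x ^- 1 by rewrite lef_pV2 ?posrE ?exprn_gt0// ler_weXn2l.
have T1 : 36 / (h%:R * x ^+ 18) * avg h sprd <= 144 * x ^- 2.
  apply: (@le_trans _ _ (36 / (h%:R * x ^+ 18) * (4 * h%:R ^+ 2))).
    by rewrite ler_wpM2l// divr_ge0// mulr_ge0// exprn_ge0// ltW.
  rewrite mulrAC ler_pdivrMr ?mulr_gt0 ?exprn_gt0//.
  rewrite [leRHS](_ : _ = 144 * h%:R * x ^+ 16); last by field; rewrite gt_eqF.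
  by have := hx'; have := hR; nra.
have T2 : x ^- 26 * avg h coll <= 1188 * x ^- 2.
  apply: le_trans (ler_wpM2l (ltW (xV 26%N)) Eco) _.
  by rewrite le_eqVlt; apply/orP; left; apply/eqP; field; rewrite gt_eqF.
have T3 : 3 * x ^- 8 * (36 / (h%:R * x ^+ 18) * avg h sprd + x ^- 26 * avg h coll) <= 3996 * x ^- 9.
  apply: (@le_trans _ _ (3 * x ^- 8 * (1332 * x ^- 1))).
    rewrite ler_wpM2l ?mulr_ge0 ?(ltW (xV 8%N))//; lra.
  by rewrite le_eqVlt; apply/orP; left; apply/eqP; field; rewrite gt_eqF.
apply: (@le_trans _ _ (q * ((75 * 349) * x ^- 9))).
  rewrite ler_wpM2l ?mulr_ge0 ?(ltW (xV 8%N))//; move: Efew T3 b16.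
  set T := 3 * x ^- 8 * _; set u := x ^- 9; set v := x ^- 16; set f := avg h few.
  rewrite /K; lra.
by rewrite le_eqVlt; apply/orP; left; apply/eqP; rewrite /q /return_const; field; rewrite gt_eqF.
Qed.

End Scale.
End ReturnBound.

(** * Summation over time of the averaged bounds *)

Section Summability.
Variable R : realType.

Definition root16 (k : nat) : R := Num.sqrt (Num.sqrt (Num.sqrt (Num.sqrt k.+1%:R))).

Lemma root16X k : root16 k ^+ 16 = k.+1%:R.
Proof.
rewrite /root16 -[16%N]/(2 * 2 * 2 * 2)%N !exprM.
by rewrite !sqr_sqrtr ?sqrtr_ge0// ler0n.
Qed.

Lemma root16_gt0 k : 0 < root16 k.
Proof. by rewrite /root16 !sqrtr_gt0 ltr0n. Qed.

Lemma root16_ge0 k : 0 <= root16 k.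
Proof. exact/ltW/root16_gt0. Qed.

Lemma root16_le j k : (j <= k)%N -> root16 j <= root16 k.
Proof.
move=> jk; rewrite -(@ler_pXn2r _ 16)// ?nnegrE ?root16_ge0// !root16X ler_nat.
exact: jk.
Qed.

(* Telescoping: [b^16 - a^16 = 1] forces [b - a >= 1 / (16 b^15)], so that
   [1/a - 1/b] dominates [1 / (16 b^17)] *)
Lemma sum_root16 N : \sum_(k < N) root16 k ^- 17 <= 17 :> R.
Proof.
have rV k : 0 < (root16 k)^-1 by rewrite invr_gt0 root16_gt0.
suff H : \sum_(k < N.+1) root16 k ^- 17 <= 17 - 16 / root16 N.
  apply: le_trans (le_trans H _); last by have := rV N; lra.
  by rewrite big_ord_recr/= lerDl invr_ge0 exprn_ge0// ltW// root16_gt0.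
elim: N => [|N IH].
  by rewrite big_ord1 /root16 !sqrtr1 expr1n invr1; lra.
rewrite big_ord_recr/= (le_trans (lerD IH (lexx _)))//.
set a := root16 N; set b := root16 N.+1.
have a0 : 0 < a := root16_gt0 N; have b0 : 0 < b := root16_gt0 N.+1.
have ab : a <= b by exact: root16_le.
have e : b ^+ 16 - a ^+ 16 = 1 by rewrite !root16X -[N.+2%:R]natr1; lra.
have h : 1 <= 16 * b ^+ 15 * (b - a).
  rewrite -[leLHS]e (_ : b ^+ 16 - a ^+ 16 = (b + a) * (b ^+ 2 + a ^+ 2) * (b ^+ 4 + a ^+ 4) * (b ^+ 8 + a ^+ 8) * (b - a)); last by ring.
  rewrite ler_wpM2r ?subr_ge0//.
  rewrite (_ : 16 * b ^+ 15 = (2 * b) * (2 * b ^+ 2) * (2 * b ^+ 4) * (2 * b ^+ 8)); last by ring.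
  have k n : 0 <= b ^+ n + a ^+ n <= 2 * b ^+ n.
    rewrite addr_ge0 ?exprn_ge0 ?(ltW a0) ?(ltW b0)//=.
    by rewrite mulr2n mulrDl mul1r lerD2l lerXn2r ?nnegrE ?(ltW a0) ?(ltW b0).
  have /andP[k10 k1] := k 1%N; have /andP[k20 k2] := k 2%N.
  have /andP[k40 k4] := k 4%N; have /andP[k80 k8] := k 8%N.
  rewrite !expr1 in k10 k1.
  by do 3 ?apply: ler_pM; rewrite ?mulr_ge0.
have h2 : b ^- 17 <= 16 * (a^-1 - b^-1).
  rewrite (_ : a^-1 - b^-1 = (b - a) / (a * b)); last by field; rewrite !gt_eqF.
  rewrite mulrA ler_pdivlMr ?mulr_gt0//.
  apply: (@le_trans _ _ (b ^- 17 * (b * b))).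
    by rewrite ler_wpM2l ?invr_ge0 ?exprn_ge0 ?(ltW b0)// ler_wpM2r// ltW.
  rewrite (_ : b ^- 17 * (b * b) = b ^- 15); last by field; rewrite gt_eqF.
  by rewrite -[leLHS]mul1r ler_pdivrMr ?exprn_gt0// mulrAC.
lra.
Qed.

Definition return_avg (y0 : int) (m : nat) (A : {set 'I_(m.*2.+1)}) : R :=
  avg m (fun s => ((sgsum (hvec (n := m) y0 s) A == 0) && (dy s == 0))%:R).

Lemma return_avg_ge0 y0 m A : 0 <= @return_avg y0 m A.
Proof. exact: avg_ge0. Qed.

Lemma return_avg_le1 y0 m A : @return_avg y0 m A <= 1.
Proof.
by apply: avg_le_cst => [|s _]; [rewrite card_step | case: (_ && _)].
Qed.

(** Pieces of length about [k / 3] give [root16 k <= 3 * root16 h], whence the factor [3 ^ 17]. It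
    also absorbs the trivial bound for [k < 3], where [h] would be [0]. *)
Lemma return_even y0 k :
  setavg (@return_avg y0 k.*2) <= return_const R * 3 ^+ 17 * root16 k ^- 17.
Proof.
have C1 : 1 <= return_const R by rewrite /return_const; lra.
have [k3|k3] := ltnP k 3.
  apply: le_trans (setavg_le_cst (@return_avg_le1 y0 k.*2)) _.
  rewrite -mulrA -[leLHS]mul1r ler_pM// ler_pdivlMr ?exprn_gt0 ?root16_gt0// mul1r.
  rewrite lerXn2r ?nnegrE ?root16_ge0//.
  rewrite -(@ler_pXn2r _ 16)// ?nnegrE ?root16_ge0// root16X -natrX ler_nat.
  by apply: leq_trans k3 _; rewrite -{1}[3%N]expn1 leq_exp2l.
pose h := (k %/ 3)%N; pose l := (k - h.*2)%N.
have hl : (h <= l)%N by rewrite /l /h; lia.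
have h0 : (0 < h)%N by rewrite /h; lia.
have e : k = (h + (h + l))%N by rewrite /l /h; lia.
have hn : ((h + (h + l)).*2 <= k.*2)%N by rewrite -e.
have := @return_scale R k.*2 y0 h (root16 h) h0 (root16_gt0 h) (root16X h) 0 0 l hl hn.
rewrite -e => /le_trans; apply.
rewrite -[leRHS]mulrA ler_wpM2l ?(le_trans ler01 C1)//.
rewrite -[leLHS]div1r ler_pdivrMr ?exprn_gt0 ?root16_gt0// mulrAC ler_pdivlMr ?exprn_gt0 ?root16_gt0//.
rewrite mul1r -exprMn lerXn2r ?nnegrE ?mulr_ge0 ?root16_ge0//.
rewrite -(@ler_pXn2r _ 16)// ?nnegrE ?mulr_ge0 ?root16_ge0// exprMn !root16X -natrX -natrM ler_nat.
apply: (@leq_trans (3 * h.+1)); first by rewrite /h; lia.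
by rewrite leq_mul2r -{1}[3%N]expn1 leq_exp2l ?orbT.
Qed.

Lemma return_odd y0 k A : @return_avg y0 k.*2.+1 A = 0.
Proof.
rewrite /return_avg; apply: etrans (avg0 _ _ _); apply: avg_eq => s sk.
case: eqP => //= h1; case: eqP => //= h2.
have [z] := parity_dx_dy (env (n := k.*2.+1) y0 A) y0 s.
by rewrite dx_env ?sk// h1 h2; lia.
Qed.

Lemma return_summable y0 N :
  \sum_(m < N) setavg (@return_avg y0 m) <= return_const R * 3 ^+ 17 * 17.
Proof.
have H k : \sum_(m < k.*2) setavg (@return_avg y0 m) = \sum_(j < k) setavg (@return_avg y0 j.*2).
  elim: k => [|k IH]; first by rewrite !big_ord0.
  rewrite doubleS !big_ord_recr/= IH (_ : setavg (@return_avg y0 k.*2.+1) = 0) ?addr0//.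
  by apply: etrans (setavg_cst _ _); apply: setavg_eq => A; exact: return_odd.
apply: (@le_trans _ _ (\sum_(m < N.*2) setavg (@return_avg y0 m))).
  rewrite -!(big_mkord predT (fun m => setavg (@return_avg y0 m))).
  rewrite [leRHS](@big_cat_nat _ _ _ N)//=; last by rewrite -addnn leq_addr.
  rewrite lerDl sumr_ge0// => m _; apply: le_trans (setavg_le (G := fun=> 0) _); first by rewrite setavg_cst.
  by move=> A; exact: return_avg_ge0.
rewrite H; apply: (@le_trans _ _ (\sum_(j < N) return_const R * 3 ^+ 17 * root16 j ^- 17)).
  by apply: ler_sum => j _; exact: return_even.
have C0 : 0 <= return_const R by rewrite /return_const; lra.
rewrite -mulr_sumr; apply: ler_wpM2l; last exact: sum_root16.
by apply: mulr_ge0; [exact: C0 | apply: exprn_ge0; exact: ler0n].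
Qed.

Definition sqdist_avg (y0 : int) (m : nat) (A : {set 'I_(m.*2.+1)}) : R :=
  avg m (fun s => (sgsum (hvec (n := m) y0 s) A)%:~R ^+ 2 + (dy s)%:~R ^+ 2).

Lemma sqdist_avg_ge0 y0 m A : 0 <= @sqdist_avg y0 m A.
Proof. by apply: avg_ge0 => s _; rewrite addr_ge0 ?sqr_ge0. Qed.

Lemma sqdist_le y0 m : setavg (@sqdist_avg y0 m) <= 298 * m%:R * Num.sqrt m%:R.
Proof.
rewrite /sqdist_avg setavg_avg.
rewrite (avg_eq (g := fun s => (\sum_i (hvec (n := m) y0 s i)%:~R ^+ 2) + (dy s)%:~R ^+ 2)); last first.
  by move=> s _; rewrite setavgD setavg_cst setavg_sgsum_sqr.
rewrite avgD; apply: (@le_trans _ _ (297 * m%:R * Num.sqrt m%:R + m%:R)).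
  apply: lerD (avg_dy_sqr R m); apply: le_trans (avg_collisions R m y0).
  apply: avg_le => s sm; rewrite -(@sum_sqr_visits m y0 y0) ?sm; last by lia.
  rewrite natr_sum; apply: ler_sum => i _; rewrite natrX /hvec -[_%:~R]/(_%:R).
  by rewrite lerXn2r ?nnegrE// ler_nat hsteps_le_visits.
case: m => [|m]; first by rewrite !mulr0 !mul0r addr0.
have : 1 <= Num.sqrt m.+1%:R :> R by rewrite -[leLHS]sqrtr1 ler_sqrt ?ltr0n// ler1n.
set r := Num.sqrt _ => r1; have : 0 <= m.+1%:R * (r - 1) by rewrite mulr_ge0 ?subr_ge0.
lra.
Qed.

Lemma sum_inv_sqr N : \sum_(k < N) (k.+1%:R ^+ 2)^-1 <= 2 :> R.
Proof.
suff H : \sum_(k < N.+1) (k.+1%:R ^+ 2)^-1 <= 2 - N.+1%:R^-1 :> R.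
  apply: le_trans (le_trans H _); last by rewrite lerBlDr lerDl invr_ge0.
  by rewrite big_ord_recr/= lerDl invr_ge0 exprn_ge0.
elim: N => [|N IH]; first by rewrite big_ord1 expr1n invr1; lra.
rewrite big_ord_recr/= (le_trans (lerD IH (lexx _)))// -[N.+2%:R]natr1.
have key (a : R) : 0 < a -> ((a + 1) ^+ 2)^-1 <= a^-1 - (a + 1)^-1.
  move=> a0; have a1 : 0 < a + 1 by rewrite addr_gt0.
  rewrite (_ : a^-1 - (a + 1)^-1 = (a * (a + 1))^-1); last first.
    by field; rewrite (gt_eqF a0) (gt_eqF a1).
  by rewrite lef_pV2 ?posrE ?mulr_gt0 ?exprn_gt0//; nra.
by rewrite -addrA lerD2l addrC lerBlDr [leRHS]addrC; apply: key.
Qed.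

(** At [m = (k + 1)^4] the bound [m^(3/2) / m^2] is [(k + 1)^-2]. *)
Lemma sqdist_summable y0 N :
  \sum_(k < N) setavg (fun A => @sqdist_avg y0 (k.+1 ^ 4) A / (k.+1 ^ 4)%:R ^+ 2) <= 298 * 2.
Proof.
apply: (@le_trans _ _ (\sum_(k < N) 298 * (k.+1%:R ^+ 2)^-1)); last first.
  by rewrite -mulr_sumr; apply: ler_wpM2l; [exact: ler0n | exact: sum_inv_sqr].
apply: ler_sum => k _; set m := (k.+1 ^ 4)%N.
rewrite (setavg_eq (G' := fun A => (m%:R ^+ 2)^-1 * @sqdist_avg y0 m A)); last first.
  by move=> A; rewrite mulrC.
rewrite setavgZ mulrC ler_pdivrMr ?exprn_gt0 ?ltr0n ?expn_gt0//.
apply: le_trans (sqdist_le y0 m) _.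
have -> : m%:R = (k.+1%:R ^+ 2) ^+ 2 :> R by rewrite /m natrX -exprM.
rewrite sqrtr_sqr ger0_norm ?exprn_ge0//.
rewrite le_eqVlt; apply/orP; left; apply/eqP.
by have : k.+1%:R != 0 :> R; [by rewrite pnatr_eq0|]; move: (k.+1%:R) => K K0; field.
Qed.

End Summability.

(** * The random environment *)

Definition window_bits (n : nat) (y0 : int) (beta : int -> bool) :
  {set 'I_n.*2.+1} := [set i | beta (level y0 i)].

Local Open Scope classical_set_scope.

(** By monotone convergence the sum of the series has a finite integral, hence is finite almost
    everywhere. It serves twice: to pass from averaged to almost sure environments and, applied to
    indicators, as the Borel-Cantelli lemma. *)
Lemma ae_bounded_sum (d : measure_display) (T : measurableType d) (R : realType)
    (mu : {measure set T -> \bar R}) (f : nat -> T -> R) (B : R) :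
  (forall k, measurable_fun setT (f k)) -> (forall k t, 0 <= f k t) ->
  (forall N, (\sum_(k < N) \int[mu]_t (f k t)%:E <= B%:E)%E) ->
  {ae mu, forall t, exists G : R, forall N, \sum_(k < N) f k t <= G}.
Proof.
move=> mf f0 fB.
pose g (t : T) : \bar R := (\sum_(k <oo) (f k t)%:E)%E.
have g0 t : (0 <= g t)%E by apply: nneseries_ge0 => k _ _; rewrite lee_fin.
have mg : measurable_fun setT g.
  apply: ge0_emeasurable_sum => // k; first by move=> *; rewrite lee_fin.
  by move=> _; apply/measurable_EFinP.
have ig : mu.-integrable setT g.
  apply/integrableP; split => //.
  under eq_integral do rewrite gee0_abs//.
  rewrite integral_nneseries//; last 2 first.
  - by move=> k; apply/measurable_EFinP.
  - by move=> k t _; rewrite lee_fin.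
  apply: (@le_lt_trans _ _ B%:E); last exact: ltry.
  apply: lime_le.
    apply: is_cvg_nneseries => k _ _; apply: integral_ge0 => t _; rewrite lee_fin.
    exact: f0.
  by apply: nearW => N; rewrite big_mkord; exact: fB.
apply: filterS (integrable_ae measurableT ig) => t /(_ I) gfin.
exists (fine (g t)) => N; rewrite -lee_fin fineK// -sumEFin.
rewrite -(big_mkord predT (fun k => (f k t)%:E)).
by apply: nneseries_lim_ge => k _ _; rewrite lee_fin.
Qed.

Lemma ae_forall_countable (d : measure_display) (T : measurableType d)
    (R : realType) (mu : {measure set T -> \bar R}) (I : countType)
    (S : I -> T -> Prop) :
  (forall i, {ae mu, forall t, S i t}) -> {ae mu, forall t, forall i, S i t}.
Proof.
move=> H.
have H' : {ae mu, forall t, forall k i, choice.unpickle k = Some i -> S i t}.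
  apply: ae_foralln => k; case E : (choice.unpickle k) => [i|].
    by apply: filterS (H i) => t h j [<-].
  by apply: aeW => t j.
by apply: filterS H' => t h i; apply: (h (choice.pickle i)); rewrite choice.pickleK.
Qed.

Section Environment.
Variables (R : realType) (d : measure_display) (Omega : measurableType d).
Variables (P : probability Omega R) (eps : int -> {RV P >-> int}).
Hypothesis eps_indep : mutually_independent eps.
Hypothesis eps_law : forall y : int,
  P (eps y @^-1` [set 1]) = (2^-1)%:E /\ P (eps y @^-1` [set -1]) = (2^-1)%:E.

(** [eps] may take values other than [1] and [-1] on a null set; the Boolean environment is defined
    everywhere. *)
Definition bit (omega : Omega) (y : int) : bool := eps y omega == 1.

Let mset (B : set int) : measurable B. Proof. by []. Qed.

Let meps (y : int) (B : set int) : measurable (eps y @^-1` B).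
Proof. by rewrite -[_ @^-1` _]setTI; exact: measurable_funPT. Qed.

Let fine_eps1 y : fine (P (eps y @^-1` [set 1])) = 2^-1.
Proof. by rewrite (eps_law y).1. Qed.

Let fine_eps1C y : fine (P (eps y @^-1` (~` [set 1]))) = 2^-1.
Proof.
rewrite -preimage_setC probability_setC; last exact: meps.
by rewrite (eps_law y).1 /=; lra.
Qed.

Lemma ae_eps_sg : {ae P, forall omega, forall y, eps y omega = sg (bit omega y)}.
Proof.
suff H y : {ae P, forall omega, eps y omega = sg (bit omega y)}.
  exact: (ae_forall_countable H).
exists (eps y @^-1` (~` ([set 1 : int] `|` [set - (1 : int)]))); split; first exact: meps.
  rewrite -preimage_setC probability_setC; last exact: meps.
  have disj : eps y @^-1` [set 1] `&` eps y @^-1` [set -1] = set0.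
    by rewrite -subset0 => omega [] /= ->.
  have -> : P (eps y @^-1` ([set 1] `|` [set -1])) = ((2^-1)%:E + (2^-1)%:E)%E.
    rewrite preimage_setU; apply: etrans (measureU _ _ _ disj) _; try exact: meps.
    by congr (_ + _)%E; [exact: (eps_law y).1 | exact: (eps_law y).2].
  by transitivity ((1 - (2^-1 + 2^-1))%:E : \bar R) => //; congr (_%:E); lra.
move=> omega /= h [] e; apply: h; rewrite /bit e /sg ?eqxx//.
Qed.

Lemma bits_law (k : nat) (z : 'I_k -> int) (A : {set 'I_k}) : injective z ->
  P [set omega | finset (fun i => bit omega (z i)) = A] = ((2 ^+ k)^-1)%:E.
Proof.
move=> z_inj.
pose J : {fset int} := [fset z i | i in 'I_k]%fset.
(* Independence wants sets indexed by heights, hence the search for [i]. The complement of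
   [[set 1]], also of probability [1/2], matches [bit] for every value of [eps]. *)
pose B (y : int) : set int := if [exists i, (z i == y) && (i \in A)] then [set 1] else ~` [set 1].
have Bz i : B (z i) = if i \in A then [set 1] else ~` [set 1].
  rewrite /B; congr (if _ then _ else _); apply/existsP/idP.
    by case=> j /andP[/eqP/z_inj ->].
  by move=> iA; exists i; rewrite eqxx.
have -> : [set omega | finset (fun i => bit omega (z i)) = A] =
    \bigcap_(j in [set` J]) (eps j @^-1` B j).
  apply/seteqP; split => omega /=.
    move=> eA j /= /imfsetP[i _ ->]; rewrite Bz -eA inE /bit.
    by case: eqP.
  move=> h; apply/setP => i; rewrite inE /bit.
  have /= := h (z i); rewrite Bz.
  have zJ : z i \in J by apply/imfsetP; exists i.
  move=> /(_ zJ); case: (i \in A) => /= [->|/eqP/negbTE//].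
  by rewrite eqxx.
have mE : measurable (\bigcap_(j in [set` J]) (eps j @^-1` B j)).
  by apply: fin_bigcap_measurable => // j _; exact: meps.
rewrite -[LHS]fineK ?fin_num_measure//; congr (_%:E).
rewrite eps_indep//.
rewrite (eq_bigr (fun=> 2^-1)); last first.
  by move=> j _; rewrite /B; case: ifP => _; rewrite ?fine_eps1 ?fine_eps1C.
rewrite big_const_seq count_predT iter_mulr_1 exprVn.
by rewrite card_imfset//= -cardE card_ord.
Qed.

Lemma bits_measurable (k : nat) (z : 'I_k -> int) (A : {set 'I_k}) :
  measurable [set omega | finset (fun i => bit omega (z i)) = A].
Proof.
have -> : [set omega | finset (fun i => bit omega (z i)) = A] =
    \bigcap_(i in [set: 'I_k]) (eps (z i) @^-1` (if i \in A then [set 1] else ~` [set 1])).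
  apply/seteqP; split => omega /=.
    move=> eA i _ /=; rewrite -eA inE /bit; by case: eqP.
  move=> h; apply/setP => i; rewrite inE /bit; have /= := h i I.
  by case: (i \in A) => /= [->|/eqP/negbTE//]; rewrite eqxx.
by apply: fin_bigcap_measurable => // j _; exact: meps.
Qed.

Lemma expectation_bits n y0 (G : {set 'I_n.*2.+1} -> R) : (forall A, 0 <= G A) ->
  measurable_fun setT (fun omega => G (window_bits n y0 (bit omega))) /\
  (\int[P]_omega (G (window_bits n y0 (bit omega)))%:E = (setavg G)%:E)%E.
Proof.
move=> G0.
pose E A := [set omega | window_bits n y0 (bit omega) = A].
have mE A : measurable (E A) by exact: bits_measurable.
have GE omega : G (window_bits n y0 (bit omega)) = \sum_A G A * \1_(E A) omega.
  rewrite (bigD1 (window_bits n y0 (bit omega)))//= big1 => [|A hA].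
    by rewrite indicE mem_set// mulr1 addr0.
  by rewrite indicE memNset ?mulr0// => /= h; rewrite h eqxx in hA.
under eq_fun do rewrite GE.
have mGE A : measurable_fun setT (fun omega => G A * \1_(E A) omega : R).
  by apply: measurable_funM => //; exact: measurable_indic.
split; first exact: measurable_sum.
under eq_integral do rewrite GE -sumEFin.
rewrite ge0_integral_sum//; last 2 first.
- by move=> A; apply/measurable_EFinP.
- by move=> A omega _; rewrite lee_fin mulr_ge0.
rewrite /setavg mulr_suml -sumEFin; apply: eq_bigr => A _.
under eq_integral do rewrite EFinM.
rewrite ge0_integralZl//; last 2 first.
- by apply/measurable_EFinP; exact: measurable_indic.
- by rewrite lee_fin.
rewrite integral_indic// setIT EFinM card_ord; congr (_ * _)%E.
exact: bits_law A (@level_inj n y0).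
Qed.

End Environment.

(** * The walk in a fixed environment *)

Section Position.
Variable beta : int -> bool.

Definition pos (u : int * int) (s : seq step) : int * int :=
  (u.1 + dx beta u.2 s, u.2 + dy s).

Lemma pos_nil u : pos u [::] = u.
Proof. by case: u => x y; rewrite /pos /= dy_nil !addr0. Qed.

Lemma pos_cat u s t : pos u (s ++ t) = pos (pos u s) t.
Proof. by rewrite /pos dx_cat dy_cat !addrA. Qed.

Lemma pos_rcons u s a : pos u (rcons s a) = pos (pos u s) [:: a].
Proof. by rewrite -cats1 pos_cat. Qed.

Lemma pos1 u a : pos u [:: a] =
  if a is Some b then (u.1, u.2 + sg b) else (u.1 + sg (beta u.2), u.2).
Proof. by case: a => [b|]; rewrite /pos /= /dy big_seq1 /= ?addr0. Qed.

Lemma pos1_inj u : injective (fun a => pos u [:: a]).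
Proof.
move=> a b e; have := congr1 (fun v => (v.1 - u.1, v.2 - u.2)) e.
rewrite !pos1 /sg.
case: (beta u.2); case: a {e} => [[]|]; case: b => [[]|];
  rewrite [X in X -> _]/= ?subrr ?(addrC u.1) ?(addrC u.2) ?addrK; by [].
Qed.

Lemma pos_eq u s : (pos u s == u) = (dx beta u.2 s == 0) && (dy s == 0).
Proof.
have e (x a : int) : (x + a == x) = (a == 0) by rewrite -[X in _ == X]addr0 (inj_eq (addrI x)).
by case: u => x y; rewrite /pos xpair_eqE !e.
Qed.

Lemma srw_trans_pos (R : realType) (u : int * int) (a : step) :
  srw_trans R (oriented_lattice (fun y => sg (beta y))) u (pos u [:: a]) = 3^-1.
Proof.
rewrite /srw_trans; set A := oriented_lattice _.
have AE v : A u v = (v \in [fset pos u [:: b] | b in [:: None; Some true; Some false]]%fset).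
  apply/idP/imfsetP => /=.
    rewrite /A /oriented_lattice; case: v => v1 v2; case/orP => /andP[/eqP/= e1].
      case/orP => /eqP/= e2.
        by exists (Some true) => //; rewrite pos1 e1 e2.
      by exists (Some false) => //; rewrite pos1 e1 e2.
    by move=> /eqP /= e2; exists None => //; rewrite pos1 e1 e2.
  by case=> b _ ->; rewrite pos1 /A /oriented_lattice; case: b => [[]|] /=; rewrite !eqxx ?orbT.
have -> : A u (pos u [:: a]).
  rewrite AE; apply/imfsetP; exists a => //.
  by case: a => [[]|].
congr (_^-1); rewrite /out_degree.
have -> : [set v | A u v] = [set` [fset pos u [:: b] | b in [:: None; Some true; Some false]]%fset].
  by apply/seteqP; split => v /=; rewrite AE.
by rewrite set_fsetK card_imfset//=; exact: pos1_inj.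
Qed.

End Position.

Section FineProbability.
Variables (d : measure_display) (T : measurableType d) (R : realType).
Variable Q : probability T R.
Implicit Types X Y : set T.

Lemma fine_probabilityU X Y : measurable X -> measurable Y -> X `&` Y = set0 ->
  fine (Q (X `|` Y)) = fine (Q X) + fine (Q Y).
Proof.
move=> mX mY XY; rewrite (_ : Q (X `|` Y) = (Q X + Q Y)%E); last exact: measureU.
by rewrite fineD// fin_num_measure.
Qed.

Lemma fine_probability_le X Y : measurable X -> measurable Y -> X `<=` Y ->
  fine (Q X) <= fine (Q Y).
Proof.
move=> mX mY XY; rewrite fine_le ?fin_num_measure//.
by apply: le_measure; rewrite ?inE.
Qed.

Lemma fine_probability_ge0 X : 0 <= fine (Q X).
Proof. by rewrite fine_ge0. Qed.

Lemma fine_probabilityID X Y : measurable X -> measurable Y ->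
  fine (Q X) = fine (Q (Y `&` X)) + fine (Q (~` Y `&` X)).
Proof.
move=> mX mY; rewrite -fine_probabilityU.
- by rewrite -setIUl setUv setTI.
- exact: measurableI.
- by apply: measurableI => //; exact: measurableC.
- by rewrite setIACA setICr set0I.
Qed.

End FineProbability.

Lemma measurable_point (v : int * int) : measurable [set v].
Proof.
rewrite [X in measurable X](_ : _ = [set v.1] `*` [set v.2]); last first.
  by apply/seteqP; split => [_ -> //|[a b] [/= -> ->]]; case: v.
exact: measurableX.
Qed.

Section Chain.
Variables (R : realType) (beta : int -> bool).
Let p := srw_trans R (oriented_lattice (fun y => sg (beta y))).
Variables (d : measure_display) (T : measurableType d) (Q : probability T R).
Variable M : nat -> {RV Q >-> (int * int)%type}.
Hypothesis Mp : markov_chain p M.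

Local Notation pos := (pos beta).
Local Notation pr X := (fine (Q X)).

Let mM k (v : int * int) : measurable (M k @^-1` [set v]).
Proof.
by rewrite -[_ @^-1` _]setTI; apply: measurable_funPT => //; exact: measurable_point.
Qed.

Local Notation prU := (fine_probabilityU Q).
Local Notation pr_le := (fine_probability_le Q).
Local Notation pr_ge0 := (fine_probability_ge0 Q).

Definition along (u : int * int) (s : seq step) : set T :=
  \bigcap_(k in `I_(size s).+1) (M k @^-1` [set pos u (take k s)]).

Lemma measurable_along u s : measurable (along u s).
Proof. by apply: bigcap_measurableType => // k _; exact: mM. Qed.

Lemma along_nil u : along u [::] = M 0%N @^-1` [set u].
Proof.
apply/seteqP; split => t /=; first by move=> /(_ 0%N isT) /=; rewrite pos_nil.
by move=> e [|k]//= _; rewrite pos_nil.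
Qed.

Lemma along_rcons u s a :
  along u (rcons s a) = M (size s).+1 @^-1` [set pos u (rcons s a)] `&` along u s.
Proof.
apply/seteqP; split => t /=.
  move=> h; split.
    by have /= := h (size s).+1; rewrite size_rcons ltnSn -{2}(size_rcons s a) take_size; exact.
  move=> k /= ks; have /= := h k; rewrite size_rcons (ltn_trans ks)// => /(_ isT) ->.
  by rewrite -cats1 takel_cat.
move=> [h1 h2] k /=; rewrite size_rcons ltnS leq_eqVlt => /orP[/eqP ->|ks].
  by rewrite h1 -(size_rcons s a) take_size.
by have /= -> := h2 k ks; rewrite -cats1 takel_cat.
Qed.

Lemma pr_along_rcons u s a : pr (along u (rcons s a)) = pr (along u s) / 3.
Proof.
pose x k := pos u (take k (rcons s a)).
have past : \bigcap_(k in `I_(size s).+1) (M k @^-1` [set x k]) = along u s.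
  apply: eq_bigcapr => k /= ks; rewrite /x -cats1 takel_cat//.
have xs : x (size s) = pos u s by rewrite /x -cats1 take_size_cat.
have xS : x (size s).+1 = pos (pos u s) [:: a].
  by rewrite /x -(size_rcons s a) take_size pos_rcons.
(* The Markov property is silent about null pasts; there both sides are [0] by monotonicity. *)
have [Q0|Q0] := eqVneq (pr (along u s)) 0.
  apply/le_anti; rewrite Q0 mul0r pr_ge0 andbT -[leRHS]Q0; apply: pr_le; try exact: measurable_along.
  by rewrite along_rcons; exact: subIsetr.
have := Mp (n := size s) (x := x); rewrite /= past xs xS.
have Qgt0 : (0 < Q (along u s))%E.
  rewrite lt0e measure_ge0 andbT; apply: contra_neq Q0 => ->//.
move=> /(_ Qgt0); rewrite /cond_prob /p srw_trans_pos along_rcons pos_rcons => <-.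
by rewrite mulrC divfK.
Qed.

Lemma pr_along u s : pr (along u s) = pr (M 0%N @^-1` [set u]) / 3 ^+ size s.
Proof.
elim/last_ind: s => [|s a IH]; first by rewrite along_nil expr0 divr1.
by rewrite pr_along_rcons IH size_rcons exprSr invfM mulrA.
Qed.

Lemma along_disjoint u s a b : a != b ->
  along u (rcons s a) `&` along u (rcons s b) = set0.
Proof.
move=> ab; rewrite -subset0 => t; rewrite !along_rcons => -[[/= e1 _] [/= e2 _]].
by move/eqP: ab; apply; apply: (@pos1_inj beta (pos u s)); rewrite -!pos_rcons -e1.
Qed.

(** The three continuations are disjoint and carry the whole mass of [along u s], so the remainder
    is null. The inequality for [B] and for its complement, with equality of the totals, forces
    equality for [B]. *)
Lemma pr_split B u s : measurable B ->
  pr (B `&` along u s) = \sum_a pr (B `&` along u (rcons s a)).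
Proof.
move=> mB.
have mF := measurable_along u.
have sub B' : measurable B' -> \sum_a pr (B' `&` along u (rcons s a)) <= pr (B' `&` along u s).
  move=> mB'; pose F a := B' `&` along u (rcons s a).
  have mF' a : measurable (F a) by exact: measurableI.
  have dF a b : a != b -> F a `&` F b = set0.
    by move=> ab; rewrite /F setIACA along_disjoint// setI0.
  rewrite sum_step -(prU (mF' _) (mF' _)) ?dF//.
  rewrite -(prU (measurableU _ _ (mF' _) (mF' _)) (mF' _)); last by rewrite setIUl !dF// setU0.
  apply: pr_le; first by do ?apply: measurableU.
    exact: measurableI.
  by move=> t [[|]|] [Bt]; rewrite along_rcons => -[].
have splt X : measurable X -> pr X = pr (B `&` X) + pr (~` B `&` X).
  by move=> mX; exact: fine_probabilityID.
have h1 := sub _ mB; have h2 := sub _ (measurableC mB).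
have h3 : pr (along u s) = \sum_a pr (along u (rcons s a)).
  by rewrite sum_step !pr_along_rcons; lra.
move: h3; rewrite (splt _ (mF s)) (eq_bigr (fun a => pr (B `&` along u (rcons s a)) +
   pr (~` B `&` along u (rcons s a)))); last by move=> a _; exact: splt.
rewrite big_split/=; lra.
Qed.

(** The bridge from chains to word averages. It bounds joint probabilities with the start at [u]
    rather than conditional ones, since the initial law may not charge [u]. *)
Lemma pr_words B u n (g : seq step -> bool) : measurable B ->
  (forall s t, size s = n -> along u s t -> B t <-> g s) ->
  pr (B `&` M 0%N @^-1` [set u]) =
  pr (M 0%N @^-1` [set u]) * avg n (fun s => (g s)%:R).
Proof.
move=> mB Bg.
have H m s : pr (B `&` along u s) = avg m (fun r => 3 ^+ m * pr (B `&` along u (s ++ r))).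
  elim: m s => [|m IH] s; first by rewrite /= cats0 expr0 mul1r.
  rewrite pr_split//= card_step ; apply/(canRL (mulfK _)) => //.
  rewrite mulr_suml; apply: eq_bigr => a _; rewrite (IH (rcons s a)) -avgZr.
  by apply: avg_eq => r _; rewrite cat_rcons exprSr mulrAC.
rewrite -along_nil (H n) -avgZ; apply: avg_eq => s sn; rewrite cat0s.
case E : (g s).
  rewrite (_ : B `&` _ = along u s).
    by rewrite pr_along sn mulr1 mulrC divfK// along_nil.
  by apply/setIidPr => t ht; apply/(Bg s t sn ht).
rewrite (_ : B `&` _ = set0) ?measure0 ?mulr0//.
by rewrite -subset0 => t [Bt ht]; have := (Bg s t sn ht).1 Bt; rewrite E.
Qed.

End Chain.

(** * Last-visit decomposition and transience *)

Section Renewal.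
Variables (R : realType) (beta : int -> bool).
Local Notation pos := (pos beta).

Definition returns (u : int * int) (s : seq step) : bool :=
  has (fun k => pos u (take k.+1 s) == u) (iota 0 (size s)).

Lemma returnsP u s :
  reflect (exists2 k, (k < size s)%N & pos u (take k.+1 s) = u) (returns u s).
Proof.
apply: (iffP hasP) => -[k]; first by rewrite mem_iota => /andP[_ ks] /eqP; exists k.
by move=> ks /eqP; exists k => //; rewrite mem_iota.
Qed.

Lemma last_visit u s :
  exists2 n, (n <= size s)%N & pos u (take n s) = u /\ ~~ returns u (drop n s).
Proof.
have [m] := ubnP (size s); elim: m s => // m IH s sm.
have [/returnsP[k ks hk]|nr] := boolP (returns u s); last first.
  by exists 0%N; rewrite // take0 drop0 pos_nil.
have [|n ns [h1 h2]] := IH (drop k.+1 s); first by rewrite size_drop; lia.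
exists (n + k.+1)%N; first by rewrite size_drop in ns; lia.
rewrite addnC takeD pos_cat hk h1; split => //.
by rewrite addnC -drop_drop.
Qed.

Definition return_prob (y : int) (n : nat) : R :=
  avg n (fun s => ((dx beta y s == 0) && (dy s == 0))%:R).

Definition noreturn_prob (u : int * int) (n : nat) : R :=
  avg n (fun s => (~~ returns u s)%:R).

Let step_gt0 : (0 < #|{: step}|)%N. Proof. by rewrite card_step. Qed.

(** Every word has a last visit to [u]. What follows it is read from [u] again, so the average over
    the two parts factors; only the height of [u] matters for returning, as the environment depends
    on the line alone. *)
Lemma last_visit_sum u N :
  1 <= \sum_(n < N.+1) return_prob u.2 n * noreturn_prob u (N - n).
Proof.
pose g (n : 'I_N.+1) s : R := (pos u (take n s) == u)%:R * (~~ returns u (drop n s))%:R.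
have -> : \sum_(n < N.+1) return_prob u.2 n * noreturn_prob u (N - n) = avg N (fun s => \sum_n g n s).
  rewrite avg_sum; apply: eq_bigr => n _; rewrite -avgZr.
  rewrite -[X in _ = avg X _](subnKC (leq_ord n)) avg_cat; apply: avg_eq => s sn.
  rewrite -avgZ; apply: avg_eq => t _.
  by rewrite /g -sn take_size_cat// drop_size_cat// pos_eq.
rewrite -[leLHS](avg_cst step_gt0 N); apply: avg_le => s sN.
have [n ns [h1 h2]] := last_visit u s; rewrite sN -ltnS in ns.
rewrite (bigD1 (Ordinal ns))//= {1}/g /= h1 h2 eqxx mulr1 lerDl.
by apply: sumr_ge0 => i _; rewrite mulr_ge0.
Qed.

(* If the no-return probabilities tended to [0], then summing [last_visit_sum]
   over [N < K] would bound [K] by [G] times a quantity that is [o(K)]. *)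
Lemma noreturn_lower u (G : R) :
  (forall N, \sum_(n < N) return_prob u.2 n <= G) ->
  exists2 delta : R, 0 < delta & forall J, exists2 j, (J <= j)%N & delta < noreturn_prob u j.
Proof.
move=> rG.
have r0 n : 0 <= return_prob u.2 n by exact: avg_ge0.
have c0 n : 0 <= noreturn_prob u n by exact: avg_ge0.
have c1 n : noreturn_prob u n <= 1.
  by apply: avg_le_cst => // s _; case: (~~ _).
have G0 : 0 <= G by have := rG 0%N; rewrite big_ord0.
(* Chosen so that [G * delta <= 1/2], with [G + 1] to keep it defined at [G = 0]; [bound] then
   yields [K <= 2 * G * J] for all [K]. *)
pose delta : R := (2 * (G + 1))^-1.
have d0 : 0 < delta by rewrite invr_gt0; lra.
exists delta => // J; apply: contrapT => H.
have small j : (J <= j)%N -> noreturn_prob u j <= delta.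
  by move=> Jj; rewrite leNgt; apply/negP => lt; apply: H; exists j.
have triv K : \sum_(j < K) noreturn_prob u j <= K%:R.
  by rewrite -[in leRHS](card_ord K) -sumr_const; exact: ler_sum.
have csum K : \sum_(j < K) noreturn_prob u j <= J%:R + K%:R * delta.
  elim: K => [|K IH]; first by rewrite big_ord0 mul0r addr0.
  have [JK|KJ] := leqP J K; last first.
    apply: le_trans (triv K.+1) _.
    by apply: (@le_trans _ _ J%:R); rewrite ?ler_nat// lerDl mulr_ge0// ltW.
  rewrite big_ord_recr/=; apply: le_trans (lerD IH (small _ JK)) _.
  by rewrite -natr1 mulrDl mul1r addrA.
have bound K : K%:R <= G * (J%:R + K%:R * delta).
  apply: (@le_trans _ _ (\sum_(N < K) \sum_(n < N.+1) return_prob u.2 n * noreturn_prob u (N - n))).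
    rewrite -[in leLHS](card_ord K) -sumr_const; apply: ler_sum => N _.
    exact: last_visit_sum.
  apply: (@le_trans _ _ (\sum_(n < K) return_prob u.2 n * \sum_(j < K) noreturn_prob u j)); last first.
    by rewrite -mulr_suml; apply: ler_pM => //; apply: sumr_ge0.
  (* The convolution is extended by zero from the triangle to the square, so that the two sums can
     be exchanged. *)
  pose F N n := if (n <= N)%N then return_prob u.2 n * noreturn_prob u (N - n) else 0.
  rewrite (eq_bigr (fun N : 'I_K => \sum_(n < K) F N n)); last first.
    move=> N _; rewrite /F -big_mkcond/=.
    rewrite (big_ord_widen_cond K xpredT (fun n => return_prob u.2 n * noreturn_prob u (N - n)))//.
  rewrite exchange_big/=; apply: ler_sum => n _; rewrite mulr_sumr.
  rewrite /F -big_mkcond/=.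
  rewrite -(big_mkord (fun N => (n <= N)%N) (fun N => return_prob u.2 n * noreturn_prob u (N - n))).
  rewrite (@big_cat_nat _ _ _ n)//=; last exact: ltnW.
  rewrite big_nat_cond big1 ?add0r; last by move=> i /andP[/andP[_ h1] h2]; lia.
  rewrite -{1}[nat_of_ord n]add0n big_addn.
  rewrite (eq_bigl xpredT); last by move=> i; rewrite leq_addl.
  rewrite (eq_bigr (fun i => return_prob u.2 n * noreturn_prob u i)); last by move=> i _; rewrite addnK.
  rewrite -(big_mkord xpredT (fun j => return_prob u.2 n * noreturn_prob u j)).
  rewrite [leRHS](@big_cat_nat _ _ _ (K - n))//=; last exact: leq_subr.
  by rewrite lerDl; apply: sumr_ge0 => i _; rewrite mulr_ge0.
have Gd : G * delta <= 2^-1.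
  rewrite /delta invfM mulrCA -[leRHS]mulr1 ler_wpM2l//.
  by rewrite ler_pdivrMr; lra.
have [K hK] : exists K : nat, 2 * G * J%:R < K%:R.
  by exists (Num.truncn (2 * G * J%:R)).+1; rewrite truncnS_gt.
have := bound K; rewrite mulrDr mulrCA => hb.
have : K%:R * (G * delta) <= K%:R * 2^-1 by rewrite ler_wpM2l.
lra.
Qed.

End Renewal.

Lemma transient_of_summable (R : realType) (beta : int -> bool) :
  (forall y, exists G : R, forall N, \sum_(n < N) return_prob R beta y n <= G) ->
  transient (srw_trans R (oriented_lattice (fun y => sg (beta y)))).
Proof.
move=> summ u d T Q M Mp Mu.
have [G rG] := summ u.2.
have [delta d0 dj] := noreturn_lower rG.
have mM k : measurable (M k @^-1` [set u]).
  by rewrite -[_ @^-1` _]setTI; apply: measurable_funPT => //; exact: measurable_point.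
pose B j := \bigcup_(k in `I_j) (M k.+1 @^-1` [set u]).
have mB j : measurable (B j) by apply: bigcup_measurable => k _; exact: mM.
have BU : \bigcup_n (M n.+1 @^-1` [set u]) = \bigcup_j B j.
  apply/seteqP; split => t [n _]; first by move=> h; exists n.+1 => //; exists n => /=.
  by case=> k _ h; exists k.
have Bhom : {homo B : i j / (i <= j)%N >-> (i <= j)%O}.
  by move=> i j ij; apply/subsetPset => t [k /= ki h]; exists k => //=; exact: leq_trans ij.
have M0 : fine (Q (M 0%N @^-1` [set u])) = 1 by rewrite Mu.
have M0C : fine (Q (~` (M 0%N @^-1` [set u]))) = 0.
  by rewrite probability_setC// Mu subee.
have c1 j : fine (Q (B j)) = 1 - noreturn_prob R beta u j.
  rewrite (fine_probabilityID Q (mB j) (mM 0%N)) [X in _ + X](_ : _ = 0) ?addr0; last first.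
    apply/le_anti; rewrite fine_probability_ge0 andbT -[leRHS]M0C.
    apply: fine_probability_le; last exact: subIsetl.
      by apply: measurableI => //; exact: measurableC.
    exact: measurableC.
  rewrite setIC (pr_words Mp (n := j) (g := returns beta u))//; last first.
    move=> s t sj h; split.
      case=> k /= kj e; apply/returnsP; exists k; rewrite ?sj//.
      by have /= := h k.+1; rewrite sj ltnS => <-.
    case/returnsP => k ks e; exists k; rewrite /= -?sj//.
    by have /= := h k.+1; rewrite ltnS => ->.
  have s0 : (0 < #|{: step}|)%N by rewrite card_step.
  rewrite M0 mul1r; apply/eqP; rewrite eq_sym subr_eq -avgD -[X in X == _](avg_cst s0 j).
  by apply/eqP/avg_eq => s _; case: returns; rewrite /= ?addr0 ?add0r.
(* A lower bound at arbitrarily late times suffices, because the events [B] increase. *)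
have cle j : (Q (B j) <= (1 - delta)%:E)%E.
  have [j' jj' lt] := dj j.
  rewrite -[leLHS]fineK ?fin_num_measure// lee_fin.
  apply: (@le_trans _ _ (fine (Q (B j')))).
    by apply: fine_probability_le => //; apply/subsetPset; exact: Bhom.
  by rewrite c1; lra.
have mU : measurable (\bigcup_j B j) by exact: bigcupT_measurable.
have cvgB : (Q \o B) j @[j --> \oo] --> Q (\bigcup_j B j).
  exact: (nondecreasing_cvg_mu mB mU Bhom).
rewrite BU; apply: (@le_lt_trans _ _ (1 - delta)%:E); last by rewrite lte_fin; lra.
rewrite -(cvg_lim _ cvgB)//; apply: lime_le; first by apply/cvg_ex; eexists; exact: cvgB.
exact: nearW.
Qed.

(** * Zero speed *)

Lemma floor_root4 n : exists K, (K ^ 4 <= n < K.+1 ^ 4)%N.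
Proof.
elim: n => [|n [K /andP[h1 h2]]]; first by exists 0%N.
have [lt|ge] := ltnP n.+1 (K.+1 ^ 4); first by exists K; rewrite lt andbT ltnW.
exists K.+1; rewrite ge /=; apply: leq_ltn_trans h2 _.
by rewrite ltn_exp2r.
Qed.

(** Consecutive fourth powers differ by [O(K^3)], negligible against [K^4], so control along them
    suffices. The tolerances are the countably many [1 / (j + 1)], which suits almost sure
    statements. *)
Lemma lipschitz_speed (R : realType) (a : nat -> int) (b : int) :
  (forall n, `|a n.+1 - a n| <= 1) ->
  (forall j, \forall k \near \oo, `|a (k.+1 ^ 4)%N - b|%:~R <= (j.+1%:R)^-1 * (k.+1 ^ 4)%:R :> R) ->
  ((a n)%:~R / n%:R : R) @[n --> \oo] --> (0 : R).
Proof.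
move=> a1 ab; apply/cvgr0Pnorm_le => e e0.
have lip m n : (m <= n)%N -> `|a n - a m| <= (n - m)%N%:Z.
  move=> /subnK <-; elim: (n - m)%N => [|k IH]; first by rewrite add0n subrr normr0.
  rewrite addnK in IH *; have := a1 (k + m)%N; rewrite -addSn; lia.
pose j := Num.truncn (3 / e).
have je : (j.+1%:R)^-1 <= e / 3.
  rewrite -[e / 3]invrK lef_pV2 ?posrE ?invr_gt0 ?divr_gt0 ?ltr0n//.
  by rewrite invf_div ltW// truncnS_gt.
have [k0 _ hk0] := ab j.
(* One summand for each third of [e]: the deviation at [K ^ 4], the gap [15 * K^3] (hence [45]), and
   the starting point [b]. *)
pose K0 := (k0.+1 + (Num.truncn (45 / e)).+1 + (Num.truncn (3 * `|b|%:~R / e)).+1)%N.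
exists (K0 ^ 4)%N => // n /= hn.
have [K /andP[K1 K2]] := floor_root4 n.
have KK0 : (K0 <= K)%N by rewrite -ltnS -(ltn_exp2r _ _ (isT : 0 < 4)%N); apply: leq_ltn_trans K2.
have Kgt0 : (0 < K)%N by apply: leq_trans KK0; rewrite /K0; lia.
have hK : `|a (K ^ 4)%N - b|%:~R <= (j.+1%:R)^-1 * (K ^ 4)%:R :> R.
  have := hk0 K.-1; rewrite prednK//; apply => /=; rewrite -ltnS prednK//.
  by apply: leq_trans KK0; rewrite /K0; lia.
have KR : 0 < K%:R :> R by rewrite ltr0n.
have K3 : 45 <= e * K%:R.
  rewrite mulrC -ler_pdivrMr//; apply: ltW; apply: lt_le_trans (truncnS_gt _) _.
  by rewrite ler_nat; apply: leq_trans KK0; rewrite /K0 addnAC leq_addl.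
have Kb : 3 * `|b|%:~R <= e * K%:R.
  rewrite [e * _]mulrC -ler_pdivrMr//; apply: ltW; apply: lt_le_trans (truncnS_gt _) _.
  by rewrite ler_nat; apply: leq_trans KK0; rewrite /K0 leq_addl.
have nR : (K ^ 4)%:R <= n%:R :> R by rewrite ler_nat.
have n0 : 0 < n%:R :> R by apply: lt_le_trans nR; rewrite ltr0n expn_gt0 Kgt0.
rewrite normrM normfV (ger0_norm (ltW n0)) ler_pdivrMr// -intr_norm.
have gap : ((n - K ^ 4)%N%:R <= 15 * K%:R ^+ 3 :> R).
  rewrite -natrX -natrM ler_nat; move: K2 Kgt0; clear; move=> K2 K0.
  have : (K.+1 ^ 4 = K ^ 4 + 4 * K ^ 3 + 6 * K ^ 2 + 4 * K + 1)%N by ring.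
  move: K2; set x := (K.+1 ^ 4)%N => K2 e.
  have e3 : (K ^ 3 = K * K ^ 2)%N by []. have e2 : (K ^ 2 = K * K)%N by [].
  nia.
have tri : `|a n| <= `|a n - a (K ^ 4)%N| + `|a (K ^ 4)%N - b| + `|b| by clear; lia.
have l1 : `|a n - a (K ^ 4)%N|%:~R <= (n - K ^ 4)%N%:R :> R.
  by rewrite -[leRHS]/((_%:Z)%:~R) ler_int; exact: lip.
have : `|a n|%:~R <= `|a n - a (K ^ 4)%N|%:~R + `|a (K ^ 4)%N - b|%:~R + `|b|%:~R :> R.
  by rewrite -!intrD ler_int.
have p1 : `|a (K ^ 4)%N - b|%:~R <= e / 3 * n%:R.
  apply: le_trans hK _; apply: ler_pM => //.
have p2 : 15 * K%:R ^+ 3 <= e / 3 * n%:R.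
  apply: (@le_trans _ _ (e / 3 * (K ^ 4)%:R)); last by rewrite ler_wpM2l// divr_ge0// ltW.
  rewrite natrX [K%:R ^+ 4]exprS mulrA ler_wpM2r ?exprn_ge0//; lra.
have p3 : `|b|%:~R <= e / 3 * n%:R.
  apply: (@le_trans _ _ (e / 3 * K%:R)); first by lra.
  rewrite ler_wpM2l ?divr_ge0 ?(ltW e0)//; apply: le_trans nR.
  by rewrite ler_nat -{1}[K]expn1 leq_pexp2l.
lra.
Qed.

Section ZeroSpeed.
Variables (R : realType) (beta : int -> bool).

Definition sqdist (y : int) (n : nat) : R :=
  avg n (fun s => (dx beta y s)%:~R ^+ 2 + (dy s)%:~R ^+ 2).

Hypothesis summ : forall y, exists G : R, forall N,
  \sum_(k < N) sqdist y (k.+1 ^ 4) / (k.+1 ^ 4)%:R ^+ 2 <= G.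

Let p := srw_trans R (oriented_lattice (fun y => sg (beta y))).
Variables (d : measure_display) (T : measurableType d) (Q : probability T R).
Variable M : nat -> {RV Q >-> (int * int)%type}.
Hypothesis Mp : markov_chain p M.

Lemma measurable_at k (S : set (int * int)) : measurable (M k @^-1` S).
Proof.
rewrite -[_ @^-1` _]setTI; apply: measurable_funPT => //.
by apply: countable_measurable; [exact: measurable_point | exact: countableP].
Qed.

(** The Markov property only constrains probabilities, so paths follow edges merely almost surely;
    the exceptional sets are indexed by the countable pairs of a length and a start. *)
Lemma ae_along : {ae Q, forall t, forall n, exists2 s, size s = n & along beta M (M 0%N t) s t}.
Proof.
pose W n u := \bigcup_(s in [set s | size s = n]) along beta M u s.
have mW n u : measurable (W n u).
  rewrite /W bigcup_mkcond; apply: countable_bigcupT_measurable; first exact: countableP.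
  by move=> s; case: ifP => _ //; exact: measurable_along.
suff H (nu : nat * (int * int)) : {ae Q, forall t, M 0%N t = nu.2 -> W nu.1 nu.2 t}.
  apply: filterS (ae_forall_countable H) => t h n.
  by have [s sn hs] := h (n, M 0%N t) erefl; exists s.
case: nu => n u /=; exists (~` W n u `&` M 0%N @^-1` [set u]); split.
- by apply: measurableI; [exact: measurableC | exact: measurable_at].
- rewrite -[LHS]fineK ?fin_num_measure//; last first.
    by apply: measurableI; [exact: measurableC | exact: measurable_at].
  (* No path following a word of length [n] meets the complement of [W n u], so this event is
     encoded by the empty predicate. *)
  rewrite (pr_words Mp (n := n) (g := xpred0))//; last 2 first.
  + exact: measurableC.
  + by move=> s t sn h; split => // -[]; exists s.
  by rewrite avg0 mulr0.
- move=> t /= h; split; last by apply: contrapT => h'; apply: h.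
  by move=> hW; apply: h.
Qed.

Lemma along_step t n s : along beta M (M 0%N t) s t -> (n < size s)%N ->
  exists a, M n.+1 t = pos beta (M n t) [:: a].
Proof.
move=> h ns; exists (nth None s n).
have /= -> := h n.+1; last by rewrite ltnS.
have /= -> := h n; last by rewrite ltnS ltnW.
by rewrite (take_nth None)// pos_rcons.
Qed.

Lemma ae_steps : {ae Q, forall t, forall n,
  `|(M n.+1 t).1 - (M n t).1| <= 1 /\ `|(M n.+1 t).2 - (M n t).2| <= 1}.
Proof.
apply: filterS ae_along => t h n; have [s sn hs] := h n.+1.
have [|a ->] := along_step hs (n := n); first by rewrite sn.
rewrite pos1; case: a => [b|] /=; split;
  by rewrite ?subrr ?normr0// addrAC subrr add0r /sg; case: ifP.
Qed.

Definition far (j : nat) (u v : int * int) (k : nat) : bool :=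
  ((j.+1%:R)^-1 * (k.+1 ^ 4)%:R < `|v.1 - u.1|%:~R :> R) ||
  ((j.+1%:R)^-1 * (k.+1 ^ 4)%:R < `|v.2 - u.2|%:~R :> R).

Lemma far_le j u s k : size s = (k.+1 ^ 4)%N ->
  (far j u (pos beta u s) k)%:R <=
  j.+1%:R ^+ 2 * (((dx beta u.2 s)%:~R ^+ 2 + (dy s)%:~R ^+ 2) / (k.+1 ^ 4)%:R ^+ 2) :> R.
Proof.
move=> _; rewrite /far /pos /= ![_ + _ - _]addrAC !subrr !add0r.
set n := (k.+1 ^ 4)%N; have n0 : 0 < n%:R :> R by rewrite ltr0n expn_gt0.
set J : R := j.+1%:R; have J0 : 0 < J by rewrite ltr0n.
have key (z : int) : J^-1 * n%:R < `|z|%:~R -> n%:R ^+ 2 <= J ^+ 2 * z%:~R ^+ 2 :> R.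
  move=> h; rewrite -[z%:~R ^+ 2]ger0_norm ?sqr_ge0// normrX -intr_norm -exprMn.
  rewrite lerXn2r ?nnegrE ?mulr_ge0 ?ler0z ?(ltW J0)// ltW//.
  by rewrite -ltr_pdivrMl.
rewrite mulrA ler_pdivlMr ?exprn_gt0//.
case: orP => [h|_] /=; last by rewrite mul0r mulr_ge0 ?exprn_ge0 ?addr_ge0 ?sqr_ge0 ?(ltW J0).
rewrite mul1r mulrDr.
case: h => /key h; apply: (le_trans h).
  by rewrite lerDl mulr_ge0 ?sqr_ge0.
by rewrite lerDr mulr_ge0 ?sqr_ge0.
Qed.

Lemma ae_near j u : {ae Q, forall t, M 0%N t = u ->
  \forall k \near \oo, ~~ far j u (M (k.+1 ^ 4)%N t) k}.
Proof.
have [G hG] := summ u.2.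
(* The start is part of the event, as the initial law is arbitrary. *)
pose E k := (M (k.+1 ^ 4)%N @^-1` [set v | far j u v k]) `&` M 0%N @^-1` [set u].
have mE k : measurable (E k) by apply: measurableI; exact: measurable_at.
have PE k : fine (Q (E k)) <= j.+1%:R ^+ 2 * (sqdist u.2 (k.+1 ^ 4) / (k.+1 ^ 4)%:R ^+ 2).
  rewrite /E (pr_words Mp (n := (k.+1 ^ 4)%N) (g := fun s => far j u (pos beta u s) k)); last 2 first.
  - exact: measurable_at.
  - by move=> s t ss h; rewrite /=; have /= := h (k.+1 ^ 4)%N; rewrite ss take_oversize ?ss// => ->.
  apply: (@le_trans _ _ (1 * avg (k.+1 ^ 4)%N (fun s => (far j u (pos beta u s) k)%:R))).
    rewrite ler_wpM2r ?avg_ge0//.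
    rewrite -[leRHS]/(fine 1%E) fine_le ?fin_num_measure//; first exact: measurable_at.
    by apply: probability_le1; exact: measurable_at.
  rewrite mul1r /sqdist -avgZr -avgZ; apply: avg_le => s ss; exact: far_le.
pose f k t : R := \1_(E k) t.
have mf k : measurable_fun setT (f k) by exact: measurable_indic.
have f0 k t : 0 <= f k t by rewrite /f indicE.
have fB N : (\sum_(k < N) \int[Q]_t (f k t)%:E <= (j.+1%:R ^+ 2 * G)%:E)%E.
  rewrite (eq_bigr (fun k : 'I_N => (fine (Q (E k)))%:E)); last first.
    by move=> k _; rewrite integral_indic// setIT fineK ?fin_num_measure.
  rewrite sumEFin lee_fin; apply: (@le_trans _ _ (j.+1%:R ^+ 2 *
     \sum_(k < N) (sqdist u.2 (k.+1 ^ 4) / (k.+1 ^ 4)%:R ^+ 2))).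
    by rewrite mulr_sumr; apply: ler_sum => k _; exact: PE.
  by rewrite ler_wpM2l// exprn_ge0.
apply: filterS (ae_bounded_sum mf f0 fB) => t [B hB] tu.
have [k0 hk0] : exists k0, forall k, (k0 <= k)%N -> ~~ far j u (M (k.+1 ^ 4)%N t) k.
  apply: contrapT => H.
  have inf k0 : exists2 k, (k0 <= k)%N & far j u (M (k.+1 ^ 4)%N t) k.
    apply: contrapT => H'; apply: H; exists k0 => k kk0.
    by apply/negP => fk; apply: H'; exists k.
  have big m : exists N, m%:R <= \sum_(k < N) f k t.
    elim: m => [|m [N hN]]; first by exists 0%N; rewrite big_ord0.
    have [k Nk fk] := inf N; exists k.+1; rewrite big_ord_recr/= -natr1 lerD//.
      apply: le_trans hN _; rewrite -!(big_mkord xpredT (fun k => f k t)).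
      by rewrite [leRHS](@big_cat_nat _ _ _ N)//= lerDl sumr_ge0.
    by rewrite /f indicE mem_set.
  have [N hN] := big (Num.truncn B).+1.
  by have := le_lt_trans (le_trans hN (hB N)) (truncnS_gt B); rewrite ltxx.
by exists k0.
Qed.

Lemma ae_velocity :
  {ae Q, forall t, velocity R (fun n => M n t) @ \oo --> ((0, 0) : R * R)}.
Proof.
have H := ae_forall_countable (fun ju : nat * (int * int) => ae_near ju.1 ju.2).
apply: filterS2 H ae_steps => t near_ step_.
have nr j := near_ (j, M 0%N t) erefl.
have c1 : ((M n t).1%:~R / n%:R : R) @[n --> \oo] --> (0 : R).
  apply: (@lipschitz_speed R (fun n => (M n t).1) (M 0%N t).1); first by move=> n; case: (step_ n).
  move=> j; apply: filterS (nr j) => k /=; rewrite negb_or => /andP[h _].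
  by rewrite leNgt.
have c2 : ((M n t).2%:~R / n%:R : R) @[n --> \oo] --> (0 : R).
  apply: (@lipschitz_speed R (fun n => (M n t).2) (M 0%N t).2); first by move=> n; case: (step_ n).
  move=> j; apply: filterS (nr j) => k /=; rewrite negb_or => /andP[_ h].
  by rewrite leNgt.
exact: cvg_pair c1 c2.
Qed.

End ZeroSpeed.

Lemma window_bitsE (n : nat) (y : int) (beta : int -> bool) (s : seq step) :
  size s = n -> dx beta y s = sgsum (hvec (n := n) y s) (window_bits n y beta).
Proof. by move=> sn; rewrite (@dx_sgsum n y)// subrr normr0 add0r sn. Qed.

Theorem theorem2p11 (R : realType) (d : measure_display)
    (Omega : measurableType d) (P : probability Omega R)
    (eps : int -> {RV P >-> int})
    (eps_indep : mutually_independent eps)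
    (eps_law : forall y : int,
       P (eps y @^-1` [set 1]) = (2^-1)%:E /\
       P (eps y @^-1` [set -1]) = (2^-1)%:E) :
  {ae P, forall omega,
     let A := oriented_lattice (fun y => eps y omega) in
     transient (srw_trans R A) /\ zero_speed (srw_trans R A)}.
Proof.
have retE y n omega : return_prob R (bit eps omega) y n =
    return_avg R y (window_bits n y (bit eps omega)).
  by apply: avg_eq => s sn; rewrite (window_bitsE y (bit eps omega) sn).
have sqdE y n omega : sqdist R (bit eps omega) y n =
    sqdist_avg R y (window_bits n y (bit eps omega)).
  by apply: avg_eq => s sn; rewrite (window_bitsE y (bit eps omega) sn).
have ret y : {ae P, forall omega, exists G : R, forall N,
    \sum_(n < N) return_prob R (bit eps omega) y n <= G}.
  have E n := expectation_bits eps_indep eps_law y (@return_avg_ge0 R y n).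
  apply: (@ae_bounded_sum _ _ _ P (fun n omega => return_prob R (bit eps omega) y n)).
  - by move=> n; under eq_fun do rewrite retE; exact: (E n).1.
  - by move=> n omega; exact: avg_ge0.
  - move=> N.
    rewrite (eq_bigr (fun n : 'I_N => (setavg (@return_avg R y n))%:E)); last first.
      by move=> n _; under eq_integral do rewrite retE; exact: (E n).2.
    by rewrite sumEFin lee_fin; exact: return_summable.
have sqd y : {ae P, forall omega, exists G : R, forall N,
    \sum_(k < N) sqdist R (bit eps omega) y (k.+1 ^ 4) / (k.+1 ^ 4)%:R ^+ 2 <= G}.
  have pos_ k A : 0 <= @sqdist_avg R y (k.+1 ^ 4) A / (k.+1 ^ 4)%:R ^+ 2.
    by rewrite divr_ge0 ?exprn_ge0 ?sqdist_avg_ge0.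
  have E k := expectation_bits eps_indep eps_law y (pos_ k).
  apply: (@ae_bounded_sum _ _ _ P
    (fun k omega => sqdist R (bit eps omega) y (k.+1 ^ 4) / (k.+1 ^ 4)%:R ^+ 2)).
  - by move=> k; under eq_fun do rewrite sqdE; exact: (E k).1.
  - by move=> k omega; rewrite sqdE.
  - move=> N.
    rewrite (eq_bigr (fun k : 'I_N => (setavg (fun A =>
      @sqdist_avg R y (k.+1 ^ 4) A / (k.+1 ^ 4)%:R ^+ 2))%:E)); last first.
      by move=> k _; under eq_integral do rewrite sqdE; exact: (E k).2.
    by rewrite sumEFin lee_fin; exact: sqdist_summable.
apply: filterS3 (ae_eps_sg eps_law) (ae_forall_countable ret) (ae_forall_countable sqd).
move=> omega e hr hs.
rewrite (_ : oriented_lattice _ = oriented_lattice (fun y => sg (bit eps omega y))); last first.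
  by congr oriented_lattice; apply/funext => y; exact: e.
split; first exact: transient_of_summable.
by move=> d' T Q M Mp; exact: (ae_velocity hs Mp).
Qed.
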